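(* Let $d\ge 1$, $N\ge 2$ and $L\ge 1$ be integers, let $\mu_1,\ldots,\mu_N$ be Borel probability measures on $\mathbb{R}^d$, let $K:\mathbb{R}^d\times\mathbb{R}^d\to\mathbb{R}$ be a continuous, symmetric, strictly positive definite kernel, and let $\sigma:\mathbb{R}\to\mathbb{R}$ be a function. Let $\gamma_K$, $\mathcal{N}$ (the class of neural networks with $L$ hidden layers and activation $\sigma$), $\mathcal{N}^*$ and $M_\lambda$ be as defined in the context, where $M_\lambda$ is built from the cost $c(x_1,\ldots,x_N)=\sum_{i<j}|x_i-x_j|^2$. Suppose that the following hold: (A1) for each $i=1,\ldots,N$, $\mu_i$ vanishes on $(d-1)$-rectifiable sets and $\int_{\mathbb{R}^d}|x|^2\,\mu_i(dx)<\infty$; (A2) $K$ is bounded and Lipschitz continuous on $\mathbb{R}^d\times\mathbb{R}^d$; (A3) $\gamma_K$ is a metric on $\mathcal{P}(\mathbb{R}^d)$ and metrizes the weak topology on $\mathcal{P}(\mathbb{R}^d)$; (A4) $\sigma$ is continuous and non-constant, and there is a constant $C>0$ such that $|\sigma(r)|\le C(1+|r|^2)$ for all $r\in\mathbb{R}$; (A5) $\mathcal{N}$ is dense in $L^2(\mu_1)$ with respect to the norm $\|f\|=\big(\int_{\mathbb{R}^d}|f(x)|^2\,\mu_1(dx)\big)^{1/2}$. Let $\varepsilon^h$ and $\lambda_i^h$ ($i=2,\ldots,N$) be positive functions of $h\in(0,1)$ such that, as $h\searrow 0$, $\varepsilon^h\searrow 0$ and $\lambda_i^h\nearrow+\infty$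 for every $i=2,\ldots,N$. Write $\lambda^h=(\lambda_2^h,\ldots,\lambda_N^h)$. For each $h\in(0,1)$ let $T^h=(T_1^h,\ldots,T_N^h)\in\mathcal{N}^*$ satisfy \[ M_{\lambda^h}(T^h)-\varepsilon^h\le\inf_{T\in\mathcal{N}^*}M_{\lambda^h}(T). \] Then \[ \lim_{h\searrow 0}\sum_{i=2}^N\lambda_i^h\,\gamma_K(T_i^h\sharp\mu_1,\mu_i)^2=0. \] In particular, $T_i^h\sharp\mu_1$ converges weakly to $\mu_i$ as $h\searrow 0$ for each $i=2,\ldots,N$.
   Context: $\mathcal{P}(\mathbb{R}^d)$ is the set of all Borel probability measures on $\mathbb{R}^d$. $T\sharp\mu$ is the pushforward of $\mu$ under a Borel map $T$, i.e. $T\sharp\mu(A)=\mu(T\in A)$ for Borel sets $A$. Kernel and maximum mean discrepancy. $K$ is symmetric if $K(x,y)=K(y,x)$ for all $x,y$, and strictly positive definite if $\sum_{j,\ell=1}^n\alpha_j\alpha_\ell K(x_j,x_\ell)>0$ for every $n\ge 1$, all pairwise distinct $x_1,\ldots,x_n\in\mathbb{R}^d$ and all $(\alpha_1,\ldots,\alpha_n)\in\mathbb{R}^n\setminus\{0\}$. Let $\mathcal{H}$, with norm $\|\cdot\|_{\mathcal{H}}$, be the unique Hilbert space of functions on $\mathbb{R}^d$ having $K$ as reproducing kernel. For $\mu,\nu\in\mathcal{P}(\mathbb{R}^d)$, \[ \gamma_K(\mu,\nu)=\sup_{f\in\mathcal{H},\ \|f\|_{\mathcal{H}}\le 1}\left|\int_{\mathbb{R}^d}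 f\,d\mu-\int_{\mathbb{R}^d} f\,d\nu\right| . \] For bounded $K$ one has $\gamma_K(\mu,\nu)^2=\int_{\mathbb{R}^d\times\mathbb{R}^d}K(x,y)\,(\mu-\nu)(dx)\,(\mu-\nu)(dy)$. Neural networks. The number $L$ of hidden layers is fixed. For $D=(D_1,\ldots,D_L)\in\mathbb{N}^L$ (positive integers), put $D_0=D_{L+1}=d$, and let $\mathcal{N}_D$ be the set of all maps $G:\mathbb{R}^d\to\mathbb{R}^d$ of the form \[ G=A_{L+1}\circ\sigma\circ A_L\circ\cdots\circ\sigma\circ A_1, \] where $A_\ell(\xi)=W_\ell\xi+b_\ell$ for $\xi\in\mathbb{R}^{D_{\ell-1}}$, with arbitrary $W_\ell\in\mathbb{R}^{D_\ell\times D_{\ell-1}}$ and $b_\ell\in\mathbb{R}^{D_\ell}$, $\ell=1,\ldots,L+1$, and $\sigma$ is applied componentwise to vectors. Set $\mathcal{N}=\bigcup_{D\in\mathbb{N}^L}\mathcal{N}_D$. Let $\mathcal{N}^*$ be the set of all $N$-tuples $T=(T_1,\ldots,T_N)$ such that $T_1(x)=x$ for all $x\in\mathbb{R}^d$ and $T_i\in\mathcal{N}$ for $i=2,\ldots,N$. $L^2(\mu_1)$ is the set of all Borel measurable $f:\mathbb{R}^d\to\mathbb{R}^d$ with $\|f\|<\infty$. Density of $\mathcal{N}$ in $L^2(\mu_1)$ means: for every $f\in L^2(\mu_1)$ and every $\varepsilon>0$ there is $G\in\mathcal{N}$ with $\|G-f\|\le\varepsilon$. Penalized cost. For $\lambda=(\lambda_2,\ldots,\lambda_N)$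 with all $\lambda_i>0$ and $T=(T_1,\ldots,T_N)\in\mathcal{N}^*$, \[ M_\lambda(T)=\int_{\mathbb{R}^d}\sum_{1\le i<j\le N}|T_i(x)-T_j(x)|^2\,\mu_1(dx)+\sum_{i=2}^N\lambda_i\,\gamma_K(T_i\sharp\mu_1,\mu_i)^2\in[0,\infty]. \] $\varepsilon^h\searrow 0$ (respectively $\lambda_i^h\nearrow+\infty$) as $h\searrow 0$ means that the quantity decreases monotonically to $0$ (respectively increases monotonically to $+\infty$) as $h$ decreases to $0$. *)

(* Defs.v *)
From HB Require Import structures.
From mathcomp Require Import all_boot all_order all_algebra.
From mathcomp Require Import all_classical all_reals all_analysis.

Set Implicit Arguments.
Unset Strict Implicit.
Unset Printing Implicit Defensive.

Import Order.TTheory GRing.Theory Num.Theory.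
Import numFieldNormedType.Exports.

Local Open Scope classical_set_scope.
Local Open Scope ring_scope.

(* R^d is 'rV[R]_d with its Borel sigma-algebra. The library norm `|x| on
   'rV[R]_d is the max norm: it has the right topology, but every metric notion
   below uses the Euclidean norm [enorm]. *)
Section borel.
Context (R : realType) (d : nat).

Let borel : set (set 'rV[R]_d) := <<s (open : set (set 'rV[R]_d)) >>.

Let borel0 : borel set0. Proof. exact: sigma_algebra0. Qed.

Let borelC (A : set 'rV[R]_d) : borel A -> borel (~` A).
Proof. exact: sigma_algebraC. Qed.

Let borel_bigcup (F : (set 'rV[R]_d)^nat) :
  (forall i, borel (F i)) -> borel (\bigcup_i F i).
Proof. exact: sigma_algebra_bigcup. Qed.

HB.instance Definition _ :=
  @isMeasurable.Build (sigma_display (open : set (set 'rV[R]_d))) 'rV[R]_d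
    borel borel0 borelC borel_bigcup.

End borel.

Section euclidean.
Context (R : realType).

Definition enorm (d : nat) (x : 'rV[R]_d) : R :=
  Num.sqrt (\sum_(i < d) x ord0 i ^+ 2).

Definition elipschitz (m d : nat) (f : 'rV[R]_m -> 'rV[R]_d) : Prop :=
  exists C : R, forall x y, enorm (f x - f y) <= C * enorm (x - y).

End euclidean.

Section rectifiable.
Context (R : realType) (d : nat).
Local Open Scope ereal_scope.

Definition diam (A : set 'rV[R]_d) : \bar R :=
  ereal_sup [set (enorm (p.1 - p.2))%:E | p in A `*` A].

(* diam(A)^m, with the usual conventions diam(set0)^m = 0 for every m, and
   diam(A)^0 = 1 for A nonempty. *)
Definition diam_pow (m : nat) (A : set 'rV[R]_d) : \bar R :=
  if `[< A = set0 >] then 0 else diam A ^+ m.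

Definition hausdorff_delta (m : nat) (delta : R) (E : set 'rV[R]_d) : \bar R :=
  ereal_inf [set \sum_(k <oo) diam_pow m (U k) |
    U in [set U : (set 'rV[R]_d)^nat |
      E `<=` \bigcup_k U k /\ forall k, diam (U k) <= delta%:E]].

(* The m-dimensional Hausdorff measure, without the normalizing constant: it
   is only used to speak of null sets. *)
Definition hausdorff (m : nat) (E : set 'rV[R]_d) : \bar R :=
  ereal_sup [set hausdorff_delta m delta E | delta in [set t : R | (0 < t)%R]].

Definition rectifiable (m : nat) (E : set 'rV[R]_d) : Prop :=
  exists f : nat -> 'rV[R]_m -> 'rV[R]_d,
    (forall k, elipschitz (f k)) /\
    hausdorff m (E `\` \bigcup_k range (f k)) = 0.

Definition vanishes_on_rectifiable (m : nat) (mu : set 'rV[R]_d -> \bar R) :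
    Prop :=
  forall E : set 'rV[R]_d, measurable E -> rectifiable m E -> mu E = 0.

Definition finite_second_moment (mu : set 'rV[R]_d -> \bar R) : Prop :=
  \int[mu]_x (enorm x ^+ 2)%:E < +oo.

End rectifiable.

Section kernel.
Context (R : realType).

Definition strictly_positive_definite (X : Type) (K : X -> X -> R) : Prop :=
  forall (n : nat) (x : 'I_n -> X) (a : 'I_n -> R),
    (1 <= n)%N -> injective x -> (exists j, a j != 0) ->
    0 < \sum_(j < n) \sum_(l < n) a j * a l * K (x j) (x l).

(* A Hilbert space of functions on X with reproducing kernel K. The inner
   product is a total function, constrained on the carrier only. For K symmetric
   and positive definite such a space exists, and its carrier and its inner
   product on the carrier are unique. *)
Record rkhs (X : Type) (K : X -> X -> R) := Rkhs {
  rkhs_car : set (X -> R);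
  rkhs_dot : (X -> R) -> (X -> R) -> R;
  rkhs_car0 : rkhs_car (fun=> 0);
  rkhs_carP : forall (a : R) f g, rkhs_car f -> rkhs_car g ->
    rkhs_car (fun x => a * f x + g x);
  rkhs_dotC : forall f g, rkhs_car f -> rkhs_car g ->
    rkhs_dot f g = rkhs_dot g f;
  rkhs_dotP : forall (a : R) f g k, rkhs_car f -> rkhs_car g -> rkhs_car k ->
    rkhs_dot (fun x => a * f x + g x) k = a * rkhs_dot f k + rkhs_dot g k;
  rkhs_dot_ge0 : forall f, rkhs_car f -> 0 <= rkhs_dot f f;
  rkhs_dot_eq0 : forall f, rkhs_car f -> rkhs_dot f f = 0 -> f = (fun=> 0);
  rkhs_complete : forall u : nat -> X -> R, (forall n, rkhs_car (u n)) ->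
    (forall e : R, 0 < e -> exists n0 : nat, forall m n : nat,
      (n0 <= m)%N -> (n0 <= n)%N ->
      Num.sqrt (rkhs_dot (fun x => u m x - u n x) (fun x => u m x - u n x))
        < e) ->
    exists2 f, rkhs_car f &
      (fun n => Num.sqrt (rkhs_dot (fun x => u n x - f x)
                                   (fun x => u n x - f x))) @ \oo --> (0 : R);
  rkhs_kernel : forall x, rkhs_car (K x);
  rkhs_reproducing : forall f x, rkhs_car f -> rkhs_dot f (K x) = f x
}.

Definition rkhs_norm (X : Type) (K : X -> X -> R) (H : rkhs K) (f : X -> R) :=
  Num.sqrt (rkhs_dot H f f).

Context (d : nat).
Local Notation Rd := 'rV[R]_d.

Definition bounded_kernel (K : Rd -> Rd -> R) : Prop :=
  exists C : R, forall x y, `|K x y| <= C.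

Definition lipschitz_kernel (K : Rd -> Rd -> R) : Prop :=
  exists C : R, forall x y x' y', `|K x y - K x' y'| <=
    C * Num.sqrt (enorm (x - x') ^+ 2 + enorm (y - y') ^+ 2).

Definition mmd (K : Rd -> Rd -> R) (H : rkhs K) (mu nu : set Rd -> \bar R) :
    \bar R :=
  ereal_sup [set `| \int[mu]_x (f x)%:E - \int[nu]_x (f x)%:E |%E |
    f in [set f : Rd -> R | rkhs_car H f /\ rkhs_norm H f <= 1]].

(* Two library measures may differ outside the measurable sets, so measures
   are identified when they agree on the Borel sets. *)
Definition mmd_metric (K : Rd -> Rd -> R) (H : rkhs K) : Prop :=
  [/\ forall mu nu : probability Rd R, mmd H mu nu \is a fin_num,
      forall mu nu : probability Rd R, mmd H mu nu = 0%E <->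
        (forall A : set Rd, measurable A -> mu A = nu A),
      forall mu nu : probability Rd R, mmd H mu nu = mmd H nu mu &
      forall mu nu xi : probability Rd R,
        (mmd H mu xi <= mmd H mu nu + mmd H nu xi)%E].

Definition bounded_continuous (f : Rd -> R) : Prop :=
  continuous f /\ exists C : R, forall x, `|f x| <= C.

(* The open sets of the weak topology on P(R^d), the coarsest one that makes
   mu |-> \int f dmu continuous for every bounded continuous f. *)
Definition weakly_open (U : set (probability Rd R)) : Prop :=
  forall mu, U mu ->
    exists (n : nat) (f : 'I_n -> Rd -> R) (e : R),
      [/\ forall k, bounded_continuous (f k), 0 < e &
        forall nu : probability Rd R,
          (forall k, `| \int[nu]_x (f k x)%:E - \int[mu]_x (f k x)%:E | < e%:E)%E ->
          U nu].

Definition mmd_open (K : Rd -> Rd -> R) (H : rkhs K)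
    (U : set (probability Rd R)) : Prop :=
  forall mu, U mu -> exists2 e : R, 0 < e &
    forall nu : probability Rd R, (mmd H mu nu < e%:E)%E -> U nu.

Definition mmd_metrizes_weak (K : Rd -> Rd -> R) (H : rkhs K) : Prop :=
  forall U : set (probability Rd R), mmd_open H U <-> weakly_open U.

End kernel.

Section networks.
Context (R : realType) (sigma : R -> R).

(* Vectors are rows, hence the transposes around W *m x. *)
Definition affine (m n : nat) (W : 'M[R]_(n, m)) (b : 'rV[R]_n)
    (x : 'rV[R]_m) : 'rV[R]_n :=
  (W *m x^T)^T + b.

(* [networks_from m ws n]: networks from R^m to R^n whose hidden layers have
   the widths listed in ws. *)
Fixpoint networks_from (m : nat) (ws : seq nat) (n : nat) :
    set ('rV[R]_m -> 'rV[R]_n) :=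
  match ws with
  | [::] => [set G | exists W b, G = affine W b]
  | k :: ws' => [set G | exists (W : 'M[R]_(k, m)) (b : 'rV[R]_k) F,
      networks_from ws' F /\ G = F \o map_mx sigma \o affine W b]
  end.

Definition networks (L d : nat) : set ('rV[R]_d -> 'rV[R]_d) :=
  [set G | exists2 D : L.-tuple nat,
    all (fun k => 0 < k)%N D & networks_from D G].

(* Density of the networks in L^2(mu), for the norm
   (\int |f|^2 dmu)^(1/2) = 'N_2[|f|]. *)
Definition networks_dense (L d : nat) (mu : probability 'rV[R]_d R) : Prop :=
  forall (f : 'rV[R]_d -> 'rV[R]_d) (e : R),
    measurable_fun setT f ->
    (Lnorm mu 2%:E (fun x => (enorm (f x))%:E) < +oo)%E -> 0 < e ->
    exists2 G, networks L G &
      (Lnorm mu 2%:E (fun x => (enorm (G x - f x))%:E) <= e%:E)%E.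

End networks.

(* N-tuples are indexed by 'I_N with N = n.+2; ord0 is the first index and the
   indices i with 0 < i are the other ones. *)
Section penalized_cost.
Context (R : realType) (d n : nat).
Local Notation Rd := 'rV[R]_d.
Local Notation N := n.+2.

Definition network_tuples (sigma : R -> R) (L : nat) : set ('I_N -> Rd -> Rd) :=
  [set T | T ord0 = id /\
    forall i : 'I_N, (0 < i)%N -> networks sigma L (T i)].

Definition quadratic_cost (x : 'I_N -> Rd) : R :=
  \sum_(i < N) \sum_(j < N | (i < j)%N) enorm (x i - x j) ^+ 2.

Context (K : Rd -> Rd -> R) (H : rkhs K) (mu : 'I_N -> probability Rd R).
Local Open Scope ereal_scope.

Definition penalty (lambda : 'I_N -> R) (T : 'I_N -> Rd -> Rd) : \bar R :=
  \sum_(i < N | (0 < i)%N)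
    (lambda i)%:E * mmd H (pushforward (mu ord0) (T i)) (mu i) ^+ 2.

Definition penalized_cost (lambda : 'I_N -> R) (T : 'I_N -> Rd -> Rd) :
    \bar R :=
  \int[mu ord0]_x (quadratic_cost (fun i => T i x))%:E + penalty lambda T.

End penalized_cost.

Definition converges_weakly (R : realType) (d : nat)
    (nu : R -> set 'rV[R]_d -> \bar R) (mu : probability 'rV[R]_d R) : Prop :=
  forall f : 'rV[R]_d -> R, bounded_continuous f ->
    (fun h => \int[nu h]_x (f x)%:E)%E @ (0 : R)^'+ --> (\int[mu]_x (f x)%:E)%E.

(* Main.v *)
(** Let V(lambda) be the infimum of M_lambda over N^*. Dropping half of the penalty
    of T^h gives
      penalty(T^h) / 2 <= V(lambda^h) - V(lambda^h / 2) + eps^h,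
    and V is monotone in lambda. If V is bounded, both values converge to the same
    supremum as h decreases to 0, so the penalty tends to 0.

    V is bounded once every mu_i is approximated in MMD, to any accuracy, by images
    of mu_1 under networks with uniformly bounded second moments. Hyperplanes are
    (d-1)-rectifiable, hence mu_1-null, so the distribution function F of the first
    coordinate turns mu_1 into the uniform law on [0, 1]. Rounding to a fine lattice
    maps mu_i to a discrete law, which is the image of mu_1 under a quantile function
    of F(x_1); density of the networks in L^2(mu_1) then replaces this map by a
    network. The MMD is controlled because the unit ball of the RKHS of a Lipschitz
    kernel is equi-Holder of exponent 1/2. *)
Require Import Defs.
From HB Require Import structures.
From mathcomp Require Import all_boot all_order all_algebra.
From mathcomp Require Import all_classical all_reals all_analysis.
From mathcomp Require Import measurable_realfun ring lra.

Set Implicit Arguments.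
Unset Strict Implicit.
Unset Printing Implicit Defensive.

Import Order.TTheory GRing.Theory Num.Theory.
Import numFieldNormedType.Exports.

Local Open Scope classical_set_scope.
Local Open Scope ring_scope.

(** * Euclidean norm: inequalities between squares, and continuity *)

Section enorm_theory.
Context (R : realType).

Lemma enorm_ge0 d (x : 'rV[R]_d) : 0 <= enorm x.
Proof. exact: sqrtr_ge0. Qed.

Lemma sqr_enorm d (x : 'rV[R]_d) : enorm x ^+ 2 = \sum_i x ord0 i ^+ 2.
Proof. by rewrite sqr_sqrtr// sumr_ge0// => i _; exact: sqr_ge0. Qed.

Lemma sqr_enormB_le d (x y : 'rV[R]_d) :
  enorm (x - y) ^+ 2 <= 2 * enorm x ^+ 2 + 2 * enorm y ^+ 2.
Proof.
rewrite !sqr_enorm !mulr_sumr -big_split; apply: ler_sum => i _ /=.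
rewrite !mxE; set a := x _ _; set b := y _ _.
rewrite -subr_ge0.
have -> : 2 * a ^+ 2 + 2 * b ^+ 2 - (a - b) ^+ 2 = (a + b) ^+ 2 by ring.
exact: sqr_ge0.
Qed.

Lemma enormN d (x : 'rV[R]_d) : enorm (- x) = enorm x.
Proof. by congr Num.sqrt; apply: eq_bigr => i _; rewrite mxE sqrrN. Qed.

Lemma enormBC d (x y : 'rV[R]_d) : enorm (x - y) = enorm (y - x).
Proof. by rewrite -enormN opprB. Qed.

Lemma sqr_enormD_le d (x y : 'rV[R]_d) :
  enorm (x + y) ^+ 2 <= 2 * enorm x ^+ 2 + 2 * enorm y ^+ 2.
Proof. by have := sqr_enormB_le x (- y); rewrite opprK enormN. Qed.

(** A neighbourhood of a matrix contains a box of entrywise neighbourhoods, and a matrix has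
    finitely many entries. *)
Lemma cvg_mx (T : topologicalType) (F : set_system T) {FF : Filter F} m n
    (f : T -> 'M[R]_(m, n)) (l : 'M[R]_(m, n)) :
  (forall i j, f x i j @[x --> F] --> l i j) -> f @ F --> l.
Proof.
move=> fl A [P lP PA]; rewrite /nbhs/=.
have H : F [set x | forall ij : 'I_m * 'I_n, P ij.1 ij.2 (f x ij.1 ij.2)].
  by apply: filter_forall => -[i j]; exact: fl.
by apply: filterS H => x Hx; apply: PA => i j; exact: (Hx (i, j)).
Qed.

Lemma continuous_mx (T : topologicalType) m n (f : T -> 'M[R]_(m, n)) :
  (forall i j, continuous (fun x => f x i j)) -> continuous f.
Proof. by move=> cf x; apply: cvg_mx => i j; exact: cf. Qed.

Lemma cvg_sumr (T : Type) (F : set_system T) {FF : Filter F} (I : Type)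
    (r : seq I) (f : I -> T -> R) (l : I -> R) :
  (forall i, f i x @[x --> F] --> l i) ->
  \sum_(i <- r) f i x @[x --> F] --> \sum_(i <- r) l i.
Proof.
move=> fl; elim: r => [|i r IH].
  by rewrite big_nil; under eq_fun do rewrite big_nil; exact: cvg_cst.
by rewrite big_cons; under eq_fun do rewrite big_cons; exact: cvgD.
Qed.

Lemma enorm_continuous d : continuous (@enorm R d).
Proof.
move=> x; apply: (@continuous_comp _ _ _ (fun x : 'rV[R]_d => \sum_i x ord0 i ^+ 2)
  Num.sqrt); last exact: sqrt_continuous.
apply: (@cvg_sumr _ (nbhs x) (nbhs_filter x)) => i.
apply: (@continuous_comp _ _ _ (fun x : 'rV[R]_d => x ord0 i) (fun y : R => y ^+ 2)).
  exact: coord_continuous.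
exact: exprn_continuous.
Qed.

End enorm_theory.

(** * Measurability for the Borel sets of ['rV[R]_d] *)

Section borel_measurability.
Context (R : realType).

Lemma open_measurable_rV d (A : set 'rV[R]_d) : open A -> measurable A.
Proof. by move=> oA; apply: sub_sigma_algebra. Qed.

Lemma continuous_measurable_rV m d (f : 'rV[R]_m -> 'rV[R]_d) :
  continuous f -> measurable_fun setT f.
Proof.
move=> /continuousP cf; apply: (measurability (open : set (set 'rV[R]_d))) => //.
by move=> _ [A oA <-]; rewrite setTI; apply: open_measurable_rV; exact: cf.
Qed.

Lemma continuous_measurable_rV_R d (f : 'rV[R]_d -> R) :
  continuous f -> measurable_fun setT f.
Proof.
move=> /continuousP cf; apply: (measurability _ (RGenOpens.measurableE R)).
move=> _ [_ [a [b ->] <-]]; rewrite setTI.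
by apply: open_measurable_rV; apply: cf; exact: interval_open.
Qed.

Lemma measurable_enorm d : measurable_fun setT (@enorm R d).
Proof. by apply: continuous_measurable_rV_R; exact: enorm_continuous. Qed.

Lemma measurable_fun_coord d (i : 'I_d) :
  measurable_fun setT (fun x : 'rV[R]_d => x ord0 i).
Proof. by apply: continuous_measurable_rV_R; exact: coord_continuous. Qed.

Lemma measurable_coord d' (T : measurableType d') d (f : T -> 'rV[R]_d) i :
  measurable_fun setT f -> measurable_fun setT (fun x => f x ord0 i).
Proof. by move=> mf; exact: (measurableT_comp (measurable_fun_coord i) mf). Qed.

Lemma measurable_sqr_enormB d' (T : measurableType d') d (f g : T -> 'rV[R]_d) :
  measurable_fun setT f -> measurable_fun setT g ->
  measurable_fun setT (fun x => enorm (f x - g x) ^+ 2).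
Proof.
move=> mf mg.
rewrite (_ : (fun _ => _) =
    fun x => \sum_(i < d) (f x ord0 i - g x ord0 i) ^+ 2); last first.
  by apply/funext => x; rewrite sqr_enorm; apply: eq_bigr => i _; rewrite !mxE.
apply: measurable_sum => i; apply: measurable_funX.
by apply: measurable_funB; exact: measurable_coord.
Qed.

Lemma measurable_sqr_enorm d' (T : measurableType d') d (f : T -> 'rV[R]_d) :
  measurable_fun setT f -> measurable_fun setT (fun x => enorm (f x) ^+ 2).
Proof.
by move=> mf; apply: measurable_funX; exact: (measurableT_comp (@measurable_enorm d)).
Qed.

(** The preimage of any set of integers is a countable union of fibers. Both the lattice rounding
    and the quantile map are handled this way. *)
Lemma measurable_fun_nat_fibers d' (T : measurableType d') (f : T -> nat) :
  (forall k, measurable (f @^-1` [set k])) -> measurable_fun setT f.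
Proof.
move=> mf _ A _; rewrite setTI.
rewrite (_ : _ @^-1` _ = \bigcup_(k in A) (f @^-1` [set k])).
  exact: bigcup_measurable.
apply/seteqP; split => [x Ax|x [k Ak] /= ->//]; first by exists (f x).
Qed.

Lemma measurable_fun_from_nat d' (T : measurableType d') (v : nat -> T) :
  measurable_fun setT v.
Proof. by []. Qed.

End borel_measurability.

(** * Continuity and measurability of networks *)

Section network_continuity.
Context (R : realType) (sigma : R -> R).
Hypothesis sigma_continuous : continuous sigma.

Lemma affine_continuous m n (W : 'M[R]_(n, m)) (b : 'rV[R]_n) :
  continuous (affine W b).
Proof.
apply: continuous_mx => i j.
rewrite (_ : (fun _ => _) = fun x : 'rV[R]_m => \sum_k W j k * x i k + b i j).
  move=> x.
  have cs : \sum_k W j k * y i k @[y --> x] --> \sum_k W j k * x i k.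
    apply: (@cvg_sumr _ _ (nbhs x) (nbhs_filter x)) => k.
    have ck : y i k @[y --> x] --> x i k by exact: coord_continuous.
    exact: (cvgM (cvg_cst _) ck).
  exact: (cvgD cs (cvg_cst _)).
by apply/funext => x; rewrite !mxE; congr (_ + _); apply: eq_bigr => k _; rewrite mxE.
Qed.

Lemma networks_from_continuous m ws n (G : 'rV[R]_m -> 'rV[R]_n) :
  networks_from sigma ws G -> continuous G.
Proof.
elim: ws m G => [|k ws IH] m G /=.
  by move=> [W [b ->]]; exact: affine_continuous.
move=> [W [b [F [/IH cF ->]]]] x.
apply: continuous_comp; first exact: affine_continuous.
apply: continuous_comp; last exact: cF.
apply: continuous_mx => i j {}x.
rewrite (_ : (fun _ => _) = sigma \o (fun y : 'rV[R]_k => y i j)); last first.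
  by apply/funext => y; rewrite /= mxE.
apply: continuous_comp; first exact: coord_continuous.
exact: sigma_continuous.
Qed.

Lemma networks_measurable L d (G : 'rV[R]_d -> 'rV[R]_d) :
  networks sigma L G -> measurable_fun setT G.
Proof.
by move=> [D _ /networks_from_continuous]; exact: continuous_measurable_rV.
Qed.

End network_continuity.

(** * Pointwise estimates on the unit ball of an RKHS *)

Section rkhs_unit_ball.
Context (R : realType).

(** Cauchy-Schwarz for [f] in the unit ball: expand the nonnegative square of [g - c f], where [c]
    is the inner product of [f] and [g]. *)
Lemma rkhs_ball_dot_sqr (X : Type) (K : X -> X -> R) (H : rkhs K) f g :
  rkhs_car H f -> rkhs_norm H f <= 1 -> rkhs_car H g ->
  rkhs_dot H f g ^+ 2 <= rkhs_dot H g g.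
Proof.
move=> Hf f1 Hg.
have ff1 : rkhs_dot H f f <= 1.
  by rewrite -[X in X <= _]sqr_sqrtr ?rkhs_dot_ge0// expr_le1// sqrtr_ge0.
set c := rkhs_dot H f g; pose h := fun x => (- c) * f x + g x.
have Hh : rkhs_car H h by exact: rkhs_carP.
have := rkhs_dot_ge0 Hh.
rewrite {1}/h rkhs_dotP// (rkhs_dotC Hf Hh) (rkhs_dotC Hg Hh) /h.
rewrite !rkhs_dotP// (rkhs_dotC Hg Hf) -/c.
have : 0 <= c ^+ 2 * (1 - rkhs_dot H f f) by rewrite mulr_ge0 ?sqr_ge0 ?subr_ge0.
nra.
Qed.

Lemma rkhs_ball_sqr_le (X : Type) (K : X -> X -> R) (H : rkhs K) f x :
  rkhs_car H f -> rkhs_norm H f <= 1 -> f x ^+ 2 <= K x x.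
Proof.
move=> Hf f1; have := rkhs_ball_dot_sqr Hf f1 (rkhs_kernel H x).
by rewrite !rkhs_reproducing//; exact: rkhs_kernel.
Qed.

(** By the reproducing property [f x - f y] is the inner product of [f] with [K x - K y], and the
    right-hand side is the squared norm of that difference. *)
Lemma rkhs_ball_sqr_dist (X : Type) (K : X -> X -> R) (H : rkhs K) f x y :
  rkhs_car H f -> rkhs_norm H f <= 1 ->
  (f x - f y) ^+ 2 <= (K x x - K x y) + (K y y - K y x).
Proof.
move=> Hf f1; pose g := fun z => (- 1) * K y z + K x z.
have Kc z : rkhs_car H (K z) by exact: rkhs_kernel.
have Hg : rkhs_car H g by exact: rkhs_carP.
have dotg k : rkhs_car H k -> rkhs_dot H k g = k x - k y.
  move=> Hk; rewrite (rkhs_dotC Hk Hg) /g rkhs_dotP// !(rkhs_dotC (Kc _) Hk).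
  by rewrite !rkhs_reproducing// mulN1r addrC.
have := rkhs_ball_dot_sqr Hf f1 Hg; rewrite !dotg// /g; lra.
Qed.

End rkhs_unit_ball.

(** * Unit-ball functions of a bounded Lipschitz kernel, and their integrals *)

Section mmd_transport.
Context (R : realType) (d : nat).
Local Notation Rd := 'rV[R]_d.
Context (K : Rd -> Rd -> R) (H : rkhs K).

Lemma mmd_ge0 (mu nu : {measure set Rd -> \bar R}) : (0 <= mmd H mu nu)%E.
Proof.
apply: ereal_sup_ge; exists 0%E => //; exists (fun=> 0) => /=.
  split; first exact: rkhs_car0.
  (* Linearity gives [a = a + a] for the squared norm [a] of the zero function. *)
  have -> : rkhs_norm H (fun=> 0) = 0; last by [].
  have H0 := rkhs_car0 H.
  have := rkhs_dotP 1 H0 H0 H0; rewrite (_ : (fun _ => _) = fun=> 0); last first.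
    by apply/funext => x; rewrite mulr0 addr0.
  by rewrite /rkhs_norm mul1r => D; rewrite (_ : rkhs_dot _ _ _ = 0) ?sqrtr0//; lra.
by rewrite !integral0_eq// sube0 abse0.
Qed.

Context (M C : R).
Hypothesis K_bounded : forall x y, `|K x y| <= M.
Hypothesis K_lipschitz : forall x y x' y', `|K x y - K x' y'| <=
    C * Num.sqrt (enorm (x - x') ^+ 2 + enorm (y - y') ^+ 2).

Context (f : Rd -> R).
Hypothesis Hf : rkhs_car H f.
Hypothesis f1 : rkhs_norm H f <= 1.

(** Each bracket in [rkhs_ball_sqr_dist] compares [K] at two points differing in one argument only,
    so the Lipschitz bound gives [C * enorm (x - y)] for each. *)
Lemma rkhs_ball_holder x y : (f x - f y) ^+ 2 <= 2 * C * enorm (x - y).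
Proof.
apply: (le_trans (rkhs_ball_sqr_dist x y Hf f1)).
have s0 (a b : Rd) : Num.sqrt (enorm (a - a) ^+ 2 + enorm (a - b) ^+ 2) = enorm (a - b).
  rewrite [enorm (a - a) ^+ 2]sqr_enorm big1 ?add0r ?sqrtr_sqr ?ger0_norm ?enorm_ge0//.
  by move=> i _; rewrite !mxE subrr expr0n.
have := ler_normlW (K_lipschitz x x x y).
have := ler_normlW (K_lipschitz y y y x).
rewrite !s0 (enormBC y x); lra.
Qed.

Lemma rkhs_ball_continuous : continuous f.
Proof.
move=> x; apply/(@cvgrPdist_lt _ _ _ (nbhs x) (nbhs_filter x)) => e e0.
have cx : enorm (x - y) @[y --> x] --> (0 : R).
  have -> : 0 = enorm (x - x) :> R.
    by apply/esym/eqP; rewrite -sqrf_eq0 sqr_enorm big1// => i _; rewrite !mxE subrr expr0n.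
  have cB : continuous (fun y : Rd => (x : Rd) - y).
    apply: continuous_mx => i j y.
    rewrite (_ : (fun _ => _) = fun y : Rd => (x : Rd) i j - y i j); last first.
      by apply/funext => z; rewrite !mxE.
    have cy : z i j @[z --> y] --> y i j by exact: coord_continuous.
    exact: (cvgB (cvg_cst _) cy).
  exact: (continuous_comp (cB x) (@enorm_continuous R d _)).
have C1 : 0 < 2 * `|C| + 1 by rewrite ltr_wpDl.
have d0 : 0 < e ^+ 2 / (2 * `|C| + 1) by rewrite divr_gt0// exprn_gt0.
move/(@cvgrPdist_lt _ _ _ (nbhs x) (nbhs_filter x)) : cx => /(_ _ d0).
apply: (@filterS _ (nbhs x) (nbhs_filter x)) => y /=.
rewrite sub0r normrN ger0_norm ?enorm_ge0// ltr_pdivlMr// => hy.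
rewrite -(@ltr_pXn2r _ 2)// ?nnegrE ?ltW// real_normK ?num_real//.
apply: le_lt_trans (rkhs_ball_holder x y) (le_lt_trans _ hy).
have := enorm_ge0 (x - y); have := ler_norm C; nra.
Qed.

Lemma measurable_rkhs_ball : measurable_fun setT f.
Proof. by apply: continuous_measurable_rV_R; exact: rkhs_ball_continuous. Qed.

Lemma rkhs_ball_bounded x : `|f x| <= M + 1.
Proof.
have := rkhs_ball_sqr_le x Hf f1; have := ler_normlW (K_bounded x x).
rewrite ler_norml; nra.
Qed.

(* From (f x - f y)^2 <= 2 C |x - y|: a linear bound in |x - y|^2 up to e, since
   t <= e + t^4 / e^3. *)
Lemma rkhs_ball_dist_le e x y : 0 < e ->
  `|f x - f y| <= e + (2 * C) ^+ 2 / e ^+ 3 * enorm (x - y) ^+ 2.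
Proof.
move=> e0; set t := `|f x - f y|; set r := enorm _.
have t2 : t ^+ 2 <= 2 * C * r.
  by rewrite /t real_normK ?num_real//; exact: rkhs_ball_holder.
have t0 : 0 <= t by exact: normr_ge0.
have [te|et] := leP t e.
  rewrite (le_trans te)// lerDl; apply: mulr_ge0; last exact: sqr_ge0.
  by apply: divr_ge0; [exact: sqr_ge0|rewrite exprn_ge0// ltW].
rewrite (@le_trans _ _ ((2 * C) ^+ 2 / e ^+ 3 * r ^+ 2))//; last by rewrite lerDr ltW.
rewrite mulrAC ler_pdivlMr ?exprn_gt0// -exprMn.
apply: (@le_trans _ _ ((t ^+ 2) ^+ 2)).
  rewrite -exprM (_ : (2 * 2 = 1 + 3)%N)// exprD expr1 ler_wpM2l//.
  by rewrite lerXn2r ?nnegrE// ltW.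
by rewrite lerXn2r ?nnegrE ?sqr_ge0// (le_trans (sqr_ge0 t)).
Qed.

Lemma rkhs_ball_integrable d' (T : measurableType d') (P : probability T R)
    (X : T -> Rd) : measurable_fun setT X ->
  P.-integrable setT (fun x => (f (X x))%:E).
Proof.
move=> mX; apply: (@le_integrable _ _ _ _ _ measurableT _ (cst (M + 1)%:E)).
- apply/measurable_EFinP; exact: (measurableT_comp measurable_rkhs_ball mX).
- move=> x _ /=; rewrite lee_fin (le_trans (rkhs_ball_bounded _))// ler_norm//.
- by apply/integrableP; split=> //; rewrite integral_cst//= probability_setT mule1 ltry.
Qed.

(** The coefficients do not depend on [f], so this comparison through the mean square distance
    survives the supremum that defines [mmd]. *)
Lemma rkhs_ball_integral_dist d' (T : measurableType d') (P : probability T R)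
    (X Y : T -> Rd) (e : R) :
  measurable_fun setT X -> measurable_fun setT Y -> 0 < e ->
  (`| \int[P]_x (f (X x))%:E - \int[P]_x (f (Y x))%:E | <=
   e%:E + ((2 * C) ^+ 2 / e ^+ 3)%:E * \int[P]_x (enorm (X x - Y x) ^+ 2)%:E)%E.
Proof.
move=> mX mY e0.
have A0 : 0 <= (2 * C) ^+ 2 / e ^+ 3 by apply: divr_ge0; [exact: sqr_ge0|rewrite exprn_ge0// ltW].
have mXY : measurable_fun setT (fun x => (enorm (X x - Y x) ^+ 2)%:E).
  by apply/measurable_EFinP; exact: measurable_sqr_enormB.
have iX := rkhs_ball_integrable P mX; have iY := rkhs_ball_integrable P mY.
rewrite -integralB//=.
apply: (@le_trans _ _ (\int[P]_x `|(f (X x))%:E - (f (Y x))%:E|)%E).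
  apply: le_abse_integral => //.
  by have /integrableP[] := integrableB measurableT iX iY.
apply: (@le_trans _ _ (\int[P]_x (e%:E +
    ((2 * C) ^+ 2 / e ^+ 3)%:E * (enorm (X x - Y x) ^+ 2)%:E))%E).
  apply: ge0_le_integral => //.
  - apply: measurableT_comp => //.
    by have /integrableP[] := integrableB measurableT iX iY.
  - by apply: emeasurable_funD => //; exact: emeasurable_funM.
  - by move=> x _; rewrite -EFinB abse_EFin -EFinM -EFinD lee_fin rkhs_ball_dist_le.
rewrite ge0_integralD//=.
- rewrite integral_cst//= probability_setT mule1 ge0_integralZl//.
  by move=> x _; rewrite lee_fin sqr_ge0.
- by move=> x _; rewrite lee_fin ltW.
- by move=> x _; rewrite mule_ge0 ?lee_fin ?sqr_ge0.
- exact: emeasurable_funM.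
Qed.

End mmd_transport.

(** * Hyperplanes are rectifiable, hence null *)

Section hyperplanes.
Context (R : realType).
Local Open Scope ereal_scope.

Lemma diam_pow_ge0 d m (A : set 'rV[R]_d) : 0 <= diam_pow m A.
Proof.
rewrite /diam_pow; case: asboolP => // /eqP/set0P[x Ax].
apply: expe_ge0; apply: (@le_trans _ _ (enorm (x - x))%:E).
  by rewrite lee_fin enorm_ge0.
by apply: ereal_sup_ubound; exists (x, x).
Qed.

Lemma hausdorff0 d m : hausdorff m (@set0 'rV[R]_d) = 0.
Proof.
have h0 (delta : R) : hausdorff_delta m delta (@set0 'rV[R]_d) = 0.
  apply/eqP; rewrite eq_le; apply/andP; split.
    apply: ereal_inf_lbound; exists (fun=> set0).
      (* The diameter of the empty set is a supremum over the empty set, that is [-oo], which lies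
         below every [delta]. *)
      by split => // _; rewrite /diam setX0 image_set0 ereal_sup0 leNye.
    by apply: eseries0 => k _ _; rewrite /diam_pow; case: asboolP.
  apply: le_ereal_inf_tmp => _ [U _ <-].
  by apply: nneseries_ge0 => k _ _; exact: diam_pow_ge0.
rewrite /hausdorff (_ : [set _ | _ in _] = [set 0]) ?ereal_sup1//.
by apply/seteqP; split => [_ [delta _ <-]|_ ->]; [exact: h0|exists 1%R => //=; exact: h0].
Qed.

(** Inserting the coordinate [t] embeds ['rV[R]_d] isometrically onto the hyperplane, so the part
    left uncovered is empty. *)
Lemma hyperplane_rectifiable d (t : R) :
  rectifiable d [set x : 'rV[R]_d.+1 | x ord0 ord0 = t].
Proof.
pose f (y : 'rV[R]_d) : 'rV[R]_d.+1 :=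
  (\row_j if unlift ord0 j is Some k then y ord0 k else t)%R.
exists (fun=> f); split.
  move=> _; exists 1%R => x y; rewrite mul1r /enorm big_ord_recl.
  rewrite !mxE unlift_none subrr expr0n add0r le_eqVlt; apply/orP; left.
  by apply/eqP; congr Num.sqrt; apply: eq_bigr => i _; rewrite !mxE liftK.
rewrite (_ : _ `\` _ = set0) ?hausdorff0//; apply/seteqP; split => // x [/= xt] [].
exists 0%N => //; exists (\row_k x ord0 (lift ord0 k))%R => //.
apply/rowP => j; rewrite !mxE; case: unliftP => [k ->|->]//=.
by rewrite mxE.
Qed.

Lemma hyperplane_null d (mu : {measure set 'rV[R]_d.+1 -> \bar R}) (t : R) :
  vanishes_on_rectifiable d mu -> mu [set x | x ord0 ord0 = t] = 0.
Proof.
move=> /(_ [set x | x ord0 ord0 = t]); apply; last exact: hyperplane_rectifiable.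
by have := @measurable_fun_coord R d.+1 ord0 measurableT _ (measurable_set1 t); rewrite setTI.
Qed.

End hyperplanes.

(** * The distribution function of an atomless random variable *)

Section atomless_cdf.
Context d (T : measurableType d) (R : realType) (P : probability T R).
Variable X : {RV P >-> R}.
Hypothesis X_atomless : forall r, P (X @^-1` [set r]) = 0%E.
Local Open Scope ereal_scope.

(** An intermediate value argument: the level [s] is attained at the infimum of the points where the
    distribution function is at least [s]. *)
Lemma atomless_cdf_surj (s : R) : (0 < s < 1)%R -> exists t, cdf X t = s%:E.
Proof.
move=> /andP[s0 s1].
have [a Ha] : exists a, forall r, (r < a)%R -> cdf X r < s%:E.
  have /fine_cvgP[_ /cvgrPdist_lt /(_ s s0) [a [_ ha]]] := cvg_cdfNy0 X.
  exists a => r /ha /=; rewrite sub0r normrN => h.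
  rewrite -[cdf X r]fineK ?fin_num_measure// lte_fin.
  by rewrite (le_lt_trans (ler_norm _) h).
have [b Hb] : exists b, s%:E <= cdf X b.
  have /fine_cvgP[_ /cvgrPdist_lt /(_ (1 - s)%R) ] := cvg_cdfy1 X.
  rewrite subr_gt0 => /(_ s1) [b [_ hb]].
  exists (b + 1)%R; have /hb /= h : (b < b + 1)%R by rewrite ltrDl.
  rewrite -[cdf X _]fineK ?fin_num_measure// lee_fin.
  have := le_lt_trans (ler_norm _) h; lra.
pose S := [set r | s%:E <= cdf X r].
have Sa r : S r -> (a <= r)%R.
  by move=> Sr; rewrite leNgt; apply/negP => /Ha; rewrite ltNge Sr.
have hS : has_inf S by split; [exists b|exists a => r /Sa].
pose t := inf S; exists t; apply/eqP; rewrite eq_le; apply/andP; split.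
(* Upper bound: without an atom at [t], the value at [t] is the limit of the values at
   [t - 1/(n+1)], and these are below [s]. *)
- have -> : cdf X t = P (X @^-1` `]-oo, t[).
    rewrite /cdf /distribution /pushforward -(@setUitv1 _ _ _ _ true)//.
    rewrite preimage_setU measureU//.
    + by rewrite [X in _ + X](X_atomless t) adde0.
    + exact: measurable_funPTI.
    + by rewrite -preimage_setI setIC -subset0 => x /= []/= ->; rewrite in_itv/= ltxx.
  pose F n := X @^-1` `]-oo, (t - n.+1%:R^-1)%R].
  have PF : P (F n) @[n --> \oo] --> P (\bigcup_n F n).
    apply: nondecreasing_cvg_mu.
    + by move=> n; exact: measurable_funPTI.
    + by apply: bigcupT_measurable => n; exact: measurable_funPTI.
    + move=> m n mn; apply/subsetPset; apply: preimage_subset; apply: subset_itvl.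
      by rewrite bnd_simp lerD2l lerN2 lef_pV2 ?posrE// ler_nat.
  rewrite (_ : _ @^-1` _ = \bigcup_n F n); last first.
    apply/seteqP; split => [x /=|x [n _] /=]; rewrite !in_itv/=.
      move=> xt; have [n Hn] : exists n : nat, (n.+1%:R^-1 < t - X x)%R.
        have tx : (0 < t - X x)%R by rewrite subr_gt0.
        have [n _ /(_ n (leqnn n)) h] := near_infty_natSinv_lt (PosNum tx).
        by exists n.
      by exists n => //; rewrite /F /= in_itv/= lerBrDr -lerBrDl ltW.
    by rewrite /F /= in_itv/= => /le_lt_trans; apply; rewrite ltrBlDr ltrDl invr_gt0.
  rewrite -(cvg_lim _ PF)//; apply: lime_le; first exact: cvgP PF.
  apply: nearW => n; apply: ltW; rewrite ltNge; apply/negP => h.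
  have : (t <= t - n.+1%:R^-1)%R by apply: ge_inf => //; case: hS.
  by rewrite leNgt ltrBlDr ltrDl invr_gt0 ltr0n.
(* Lower bound: right continuity at [t], since every [t + 1/(n+1)] lies above a point of [S]. *)
- have := @cdf_right_continuous _ _ _ _ X t.
  have [p pE] : exists p, cdf X t = p%:E.
    by exists (fine (cdf X t)); rewrite fineK// fin_num_measure.
  rewrite pE => /cvge_at_rightP H.
  have rt : (t + n.+1%:R^-1)%R @[n --> \oo] --> t.
    rewrite -[X in _ --> X]addr0; apply: (@cvgD _ R^o); first exact: cvg_cst.
    exact: cvg_harmonic.
  have c : cdf X (t + n.+1%:R^-1)%R @[n --> \oo] --> p%:E.
    by apply: (H (fun n => t + n.+1%:R^-1)%R); split => // n; rewrite ltrDl.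
  rewrite -(cvg_lim _ c)//; apply: lime_ge; first exact: cvgP c.
  apply: nearW => n.
  have [r Sr rt'] : exists2 r, S r & (r < t + n.+1%:R^-1)%R.
    by apply: inf_adherent => //; rewrite invr_gt0.
  by rewrite (le_trans Sr)// cdf_nondecreasing// ltW.
Qed.

Lemma measurable_cdf_lt (r : R) : measurable [set x | cdf X (X x) < r%:E].
Proof.
have mU : measurable_fun setT (cdf X \o X).
  exact: (measurableT_comp (cdf_measurable X) (measurable_funPT X)).
have := mU measurableT _ (emeasurable_itv `]-oo, r%:E[); rewrite setTI.
by congr measurable; apply/seteqP; split => x /=; rewrite in_itv.
Qed.

(** The probability integral transform. If [cdf X t = s], then [cdf X (X x) < s] forces [X x <= t]
    by monotonicity, which gives the upper bound. *)
Lemma atomless_cdf_uniform (s : R) : (0 <= s <= 1)%R ->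
  P [set x | cdf X (X x) < s%:E] = s%:E.
Proof.
move=> /andP[s0 s1].
have mU := measurable_cdf_lt.
apply/eqP; rewrite eq_le; apply/andP; split.
  have [->|sn0] := eqVneq s 0%R.
    rewrite (_ : [set _ | _] = set0) ?measure0// -subset0 => x /=.
    by rewrite ltNge cdf_ge0.
  have [->|sn1] := eqVneq s 1%R; first exact: probability_le1.
  have [|t Ft] := @atomless_cdf_surj s; first by rewrite !lt_neqAle eq_sym sn0 s0 sn1 s1.
  rewrite -Ft; apply: le_measure; rewrite ?inE.
  - by rewrite Ft.
  - exact: measurable_funPTI.
  - move=> x /=; rewrite in_itv/= => h; rewrite leNgt; apply/negP => tx.
    by move: h; rewrite ltNge cdf_nondecreasing// ltW.
rewrite leNgt; apply/negP => h.
set p := P _ in h; have pE : p = (fine p)%:E by rewrite fineK// fin_num_measure.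
have p0 : (0 <= fine p)%R by apply: fine_ge0; exact: measure_ge0.
rewrite pE lte_fin in h.
(* A level strictly between [p] and [s]. Where [X <= t] the transform is at most [s' < s], so
   [s' <= p], a contradiction. *)
pose s' := ((fine p + s) / 2)%R.
have [|t Ft] := @atomless_cdf_surj s'; first by rewrite /s'; apply/andP; split; lra.
have : s'%:E <= p.
  rewrite -Ft /cdf /distribution /pushforward; apply: le_measure; rewrite ?inE//.
    exact: measurable_funPTI.
  move=> x /=; rewrite in_itv/= => xt.
  by rewrite (le_lt_trans (cdf_nondecreasing _ xt))// Ft lte_fin /s'; lra.
by rewrite pE lee_fin /s'; lra.
Qed.

End atomless_cdf.

(** * Transport of an atomless law onto a law on the integers *)

Section quantile_transport.
Context d (T : measurableType d) (R : realType) (P : probability T R).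
Variable X : {RV P >-> R}.
Hypothesis X_atomless : forall r, P (X @^-1` [set r]) = 0%E.
Local Open Scope ereal_scope.

(** Domination on points extends to all sets by countable additivity; passing to complements
    reverses it, since both total masses are 1. *)
Lemma le_probability_nat (nu1 nu2 : probability nat R) :
  (forall k, nu1 [set k] <= nu2 [set k]) -> forall A : set nat, nu1 A = nu2 A.
Proof.
move=> le12.
have leA (A : set nat) : nu1 A <= nu2 A.
  have AE : A = \bigcup_(k in A) [set k].
    by apply/seteqP; split => [x Ax|x [k Ak ->]//]; exists x.
  have tA : trivIset A (fun k : nat => [set k]).
    by apply/trivIsetP => i j _ _ /eqP ij; rewrite -subset0 => x [/= -> /ij].
  rewrite AE !measure_bigcup//.
  by apply: lee_nneseries => // k _; exact: le12.
move=> A; apply/eqP; rewrite eq_le leA /=.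
have CA (nu : probability nat R) : nu A = 1 - nu (~` A).
  by rewrite -[A in LHS]setCK probability_setC.
by rewrite !CA leeB.
Qed.

(* The quantile function of nu, composed with the uniform variable cdf X \o X. *)
Lemma atomless_transport_nat (nu : probability nat R) :
  exists2 kappa : T -> nat, measurable_fun setT kappa &
    forall A : set nat, P (kappa @^-1` A) = nu A.
Proof.
pose s k := fine (nu `I_k).
have sE k : nu `I_k = (s k)%:E by rewrite fineK// fin_num_measure.
have s01 k : (0 <= s k <= 1)%R.
  by rewrite -!lee_fin -sE measure_ge0 probability_le1.
have s_mono i j : (i <= j)%N -> (s i <= s j)%R.
  move=> ij; rewrite -lee_fin -!sE; apply: le_measure; rewrite ?inE//.
  by move=> m /= mi; exact: leq_trans mi ij.
have sS k : nu [set k] = (s k.+1 - s k)%:E.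
  have : nu `I_k.+1 = nu `I_k + nu [set k].
    rewrite IIS; apply: measureU => //.
    by rewrite -subset0 => m [/= mk mE]; move: mk; rewrite mE ltnn.
  have -> : nu [set k] = (fine (nu [set k]))%:E by rewrite fineK// fin_num_measure.
  by rewrite !sE => -[->]; congr EFin; ring.
(* [D k] is the event that the uniform variable lies in [[s k, s k.+1[], an interval of length [nu
   [set k]]. *)
pose D k := [set x | cdf X (X x) < (s k.+1)%:E] `\` [set x | cdf X (X x) < (s k)%:E].
have mcdf := measurable_cdf_lt X.
have mD k : measurable (D k) by apply: measurableD.
have PD k : P (D k) = nu [set k].
  rewrite measureD//; last by rewrite (le_lt_trans (probability_le1 _ _)) ?ltry.
  rewrite setIidr; last first.
    by move=> x /= /lt_le_trans; apply; rewrite lee_fin s_mono.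
  have U j : P [set x | cdf X (X x) < (s j)%:E] = (s j)%:E.
    exact: atomless_cdf_uniform.
  rewrite sS EFinB; congr (_ - _); exact: U.
have D_inj i j x : D i x -> D j x -> i = j.
  wlog ij : i j / (i <= j)%N => [h Di Dj|].
    by have [/h|/ltnW/h] := leqP i j; [apply|move=> /(_ Dj Di)].
  move=> [Di _] [_ Dj]; move: ij; rewrite leq_eqVlt => /predU1P[//|ij].
  by exfalso; apply: Dj; rewrite /= (lt_le_trans Di)// lee_fin s_mono.
(* At most one [k] qualifies; the default 0 receives the points outside every [D k]. *)
pose kappa x := xget 0%N [set k | D k x].
have kappaD k x : D k x -> kappa x = k.
  by move=> Dk; apply: (@D_inj _ _ x) => //; rewrite /kappa; case: xgetP => // /(_ k).
have kappa0 x : (forall k, ~ D k x) -> kappa x = 0%N.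
  by move=> nD; rewrite /kappa; case: xgetP => // k _ /nD.
have mkappa : measurable_fun setT kappa.
  apply: measurable_fun_nat_fibers => k.
  have [->|k0] := eqVneq k 0%N.
    rewrite (_ : _ @^-1` _ = D 0%N `|` ~` (\bigcup_k D k)).
      by apply: measurableU => //; apply: measurableC; exact: bigcupT_measurable.
    apply/seteqP; split => x /=.
      move=> kx0; have [[j _ Dj]|nD] := pselect ((\bigcup_k D k) x); last by right.
      by left; rewrite -kx0 (kappaD _ _ Dj).
    by move=> [/kappaD//|nD]; apply: kappa0 => j Dj; apply: nD; exists j.
  rewrite (_ : _ @^-1` _ = D k)//; apply/seteqP; split => x /=; last exact: kappaD.
  move=> kx; have [[j _ Dj]|nD] := pselect ((\bigcup_k D k) x).
    by rewrite -kx (kappaD _ _ Dj).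
  by move: k0; rewrite -kx kappa0 ?eqxx// => j Dj; apply: nD; exists j.
exists kappa => // A.
pose K : {mfun T >-> nat} := HB.pack kappa (isMeasurableFun.Build _ _ _ _ kappa mkappa).
suff -> : nu A = distribution P K A by [].
(* The fiber over [k] contains [D k], so its mass dominates [nu [set k]]. Domination forces
   equality, which also settles the points sent to the default. *)
apply: le_probability_nat => k; rewrite -PD; apply: le_measure; rewrite ?inE//.
  by rewrite -[X in measurable X]setTI; exact: (mkappa measurableT _ _).
by move=> x /kappaD.
Qed.

End quantile_transport.

(** * Rounding to a lattice *)

Section lattice_quantizer.
Context (R : realType) (d : nat).

(** Each coordinate is rounded down to a multiple of [delta], with error at most [delta]. Cells are
    coded by integers, so that the law of [q] lives on [nat]. *)
Lemma lattice_quantizer (delta : R) : 0 < delta ->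
  exists (q : 'rV[R]_d -> nat) (v : nat -> 'rV[R]_d), measurable_fun setT q /\
    forall x, enorm (v (q x) - x) ^+ 2 <= d%:R * delta ^+ 2.
Proof.
move=> delta0.
pose cell (x : 'rV[R]_d) : {ffun 'I_d -> int} := [ffun j => Num.floor (x ord0 j / delta)].
pose v k : 'rV[R]_d :=
  if unpickle k is Some z then \row_j (((z : {ffun 'I_d -> int}) j)%:~R * delta) else 0.
exists (fun x => pickle (cell x)), v; split.
  apply: measurable_fun_nat_fibers => k.
  have [[z zk]|nz] := pselect (exists z : {ffun 'I_d -> int}, pickle z = k); last first.
    rewrite (_ : _ @^-1` _ = set0)// -subset0 => x /= xk.
    by apply: nz; exists (cell x).
  (* The fiber of a cell is a finite intersection of half-open slabs. *)
  rewrite (_ : _ @^-1` _ = \bigcap_(j in [set: 'I_d])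
      ((fun x : 'rV[R]_d => x ord0 j) @^-1`
         `[(z j)%:~R * delta, (z j + 1)%:~R * delta[)); last first.
    apply/seteqP; split => x /=.
      rewrite -zk => /(pcan_inj pickleK) cz j _ /=.
      have : Num.floor (x ord0 j / delta) == z j by rewrite -cz ffunE.
      by rewrite floor_eq in_itv/= ler_pdivlMr// ltr_pdivrMr.
    move=> xz; rewrite -zk; congr pickle; apply/ffunP => j; rewrite ffunE.
    apply/eqP; rewrite floor_eq ler_pdivlMr// ltr_pdivrMr//.
    by have := xz j I; rewrite /= in_itv.
  apply: fin_bigcap_measurable => // j _.
  by have := @measurable_fun_coord R d j measurableT _
    (measurable_itv `[(z j)%:~R * delta, (z j + 1)%:~R * delta[); rewrite setTI.
move=> x; rewrite /v pickleK sqr_enorm.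
rewrite (@le_trans _ _ (\sum_(j < d) delta ^+ 2))//; last first.
  by rewrite sumr_const card_ord mulr_natl.
apply: ler_sum => j _; rewrite !mxE ffunE -[X in X <= _]real_normK ?num_real//.
rewrite lerXn2r ?nnegrE ?(ltW delta0)//.
set y := x ord0 j / delta.
have -> : x ord0 j = y * delta by rewrite divfK// gt_eqF.
rewrite -mulrBl normrM (gtr0_norm delta0) ger_pMl// ler_norml.
have := floor_le y; have := floorD1_gt y.
by rewrite intrD /=; lra.
Qed.

End lattice_quantizer.

(** * Transport of one measure onto a rounding of another *)

Section approximate_transport.
Context (R : realType) (d : nat).
Local Notation Rd := 'rV[R]_d.+1.
Local Open Scope ereal_scope.

(** Both maps factor through [nat]: [q] rounds to a lattice, and [S] reproduces the law of the cells
    under [nu] from the first coordinate, which has no atoms under [mu]. *)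
Lemma approximate_transport (mu nu : probability Rd R) (delta : R) :
  vanishes_on_rectifiable d mu -> (0 < delta)%R ->
  exists (S : Rd -> Rd) (q : Rd -> Rd),
    [/\ measurable_fun setT S, measurable_fun setT q,
        forall x, (enorm (q x - x) ^+ 2 <= delta)%R &
        forall A, measurable A -> pushforward mu S A = pushforward nu q A].
Proof.
move=> mu_null delta0.
pose c : Rd -> R := fun x => x ord0 ord0.
have mc : measurable_fun setT c by exact: measurable_fun_coord.
pose X : {RV mu >-> R} := HB.pack c (isMeasurableFun.Build _ _ _ _ c mc).
have X_atomless r : mu (X @^-1` [set r]) = 0 by exact: hyperplane_null.
(* With this mesh, the [d.+1] squared coordinate errors add up to at most [delta]. *)
have D0 : (0 < Num.sqrt (delta / d.+1%:R))%R by rewrite sqrtr_gt0 divr_gt0.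
have [q [v [mq vq]]] := @lattice_quantizer R d.+1 _ D0.
pose Q : {mfun Rd >-> nat} := HB.pack q (isMeasurableFun.Build _ _ _ _ q mq).
have [kappa mkappa kappaE] := atomless_transport_nat X_atomless (distribution nu Q).
exists (v \o kappa), (v \o q); split.
- exact: (measurableT_comp (measurable_fun_from_nat v) mkappa).
- exact: (measurableT_comp (measurable_fun_from_nat v) mq).
- move=> x; apply: le_trans (vq x) _; rewrite (@sqr_sqrtr _ (delta / _)%R).
    by rewrite mulrC divfK.
  by apply: divr_ge0 => //; exact: ltW.
- by move=> A _; exact: (kappaE (v @^-1` A)).
Qed.

(** Change of variables on both sides of the common law. The nonnegative case serves second moments,
    the integrable case serves unit-ball functions. *)
Lemma pushforward_integral_eq d1 d2 d3 (T1 : measurableType d1) (T2 : measurableType d2)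
    (T3 : measurableType d3) (P1 : probability T1 R) (P2 : probability T2 R)
    (S : T1 -> T3) (q : T2 -> T3) (f : T3 -> \bar R) :
  measurable_fun setT S -> measurable_fun setT q ->
  (forall A, measurable A -> pushforward P1 S A = pushforward P2 q A) ->
  measurable_fun setT f ->
  (forall x, 0 <= f x) \/
    (P1.-integrable setT (f \o S) /\ P2.-integrable setT (f \o q)) ->
  \int[P1]_x f (S x) = \int[P2]_x f (q x).
Proof.
move=> mS mq Sq mf.
have E : \int[pushforward P1 S]_x f x = \int[pushforward P2 q]_x f x.
  by apply: eq_measure_integral => A mA _; exact: Sq.
case=> [f0|[i1 i2]].
  have g0 : {in [set: T3], forall y, 0 <= f y} by [].
  have := ge0_integral_pushforward mS P1 measurableT mf g0.
  have := ge0_integral_pushforward mq P2 measurableT mf g0.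
  by rewrite !preimage_setT => <- <-.
have := integral_pushforward mS mf i1 measurableT.
have := integral_pushforward mq mf i2 measurableT.
by rewrite !preimage_setT => <- <-.
Qed.

End approximate_transport.

(** * The norm of L^2 and integrals of squares *)

Section L2.
Context d (T : measurableType d) (R : realType) (P : probability T R).
Local Open Scope ereal_scope.

Let Lnorm2 (h : T -> R) : (forall x, 0 <= h x)%R ->
  Lnorm P 2%:E (fun x => (h x)%:E) `^ 2 = \int[P]_x (h x ^+ 2)%:E.
Proof.
move=> h0; rewrite poweR_Lnorm//; apply: eq_integral => x _ /=.
by rewrite ger0_norm// powR_mulrn.
Qed.

Lemma Lnorm2_lty (h : T -> R) : (forall x, 0 <= h x)%R ->
  \int[P]_x (h x ^+ 2)%:E < +oo -> Lnorm P 2%:E (fun x => (h x)%:E) < +oo.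
Proof. by move=> h0; rewrite -Lnorm2//; apply: lty_poweRy. Qed.

Lemma integral_sqr_le (h : T -> R) (e : R) : (forall x, 0 <= h x)%R ->
  (0 <= e)%R -> Lnorm P 2%:E (fun x => (h x)%:E) <= e%:E ->
  \int[P]_x (h x ^+ 2)%:E <= (e ^+ 2)%:E.
Proof.
move=> h0 e0; rewrite -Lnorm2//; have := Lnorm_ge0 P 2%:E (fun x => (h x)%:E).
case: (Lnorm _ _ _) => [r| |]//; rewrite !lee_fin => r0 re.
by rewrite powR_mulrn// lerXn2r.
Qed.

End L2.

(** * Second moments of nearby maps *)

Section second_moments.
Context (R : realType) (d : nat) d' (T : measurableType d') (P : probability T R).
Local Notation Rd := 'rV[R]_d.
Local Open Scope ereal_scope.

Lemma integral_sqr_enorm_le (X Y : T -> Rd) :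
  measurable_fun setT X -> measurable_fun setT Y ->
  \int[P]_x (enorm (X x) ^+ 2)%:E <=
    2%:E * \int[P]_x (enorm (X x - Y x) ^+ 2)%:E + 2%:E * \int[P]_x (enorm (Y x) ^+ 2)%:E.
Proof.
move=> mX mY.
have mX2 : measurable_fun setT (fun x => (enorm (X x) ^+ 2)%:E).
  by apply/measurable_EFinP; exact: measurable_sqr_enorm.
have mY2 : measurable_fun setT (fun x => (enorm (Y x) ^+ 2)%:E).
  by apply/measurable_EFinP; exact: measurable_sqr_enorm.
have mXY : measurable_fun setT (fun x => (enorm (X x - Y x) ^+ 2)%:E).
  by apply/measurable_EFinP; exact: measurable_sqr_enormB.
have m2 (f : T -> \bar R) : measurable_fun setT f -> measurable_fun setT (fun x => 2%:E * f x).
  by move=> mf; exact: emeasurable_funM.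
have lin (f : T -> \bar R) : measurable_fun setT f -> (forall x, 0 <= f x) ->
    2%:E * \int[P]_x f x = \int[P]_x (2%:E * f x).
  by move=> mf f0; rewrite ge0_integralZl.
have s0 (Z : Rd) : 0 <= (enorm Z ^+ 2)%:E by rewrite lee_fin sqr_ge0.
rewrite !lin//.
rewrite -ge0_integralD//; try exact: m2; last 2 first.
  by move=> x _; rewrite mule_ge0.
  by move=> x _; rewrite mule_ge0.
apply: ge0_le_integral => //.
- by apply: emeasurable_funD; exact: m2.
- by move=> x _; rewrite -!EFinM -EFinD lee_fin -{1}[X x](subrK (Y x)) sqr_enormD_le.
Qed.

End second_moments.

(** * Approximation of a measure by network images of another *)

Section network_approximation.
Context (R : realType) (d L : nat) (sigma : R -> R).
Local Notation Rd := 'rV[R]_d.+1.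
Context (K : Rd -> Rd -> R) (H : rkhs K).
Local Open Scope ereal_scope.

(* The bound b depends on neither the accuracy e nor the network G: this is what
   keeps the values of the penalized problems bounded. *)
Lemma networks_approximate (mu nu : probability Rd R) :
  continuous sigma -> networks_dense sigma L mu ->
  vanishes_on_rectifiable d mu -> finite_second_moment nu ->
  bounded_kernel K -> lipschitz_kernel K ->
  exists b : R, forall e : R, (0 < e)%R ->
    exists2 G, networks sigma L G &
      \int[mu]_x (enorm (G x) ^+ 2)%:E <= b%:E /\
      mmd H (pushforward mu G) nu <= e%:E.
Proof.
move=> sc dens mu0 nu2 [M KM] [C KC].
have mid : measurable_fun setT (@id Rd) by exact: measurable_id.
set m2 := \int[nu]_x (enorm x ^+ 2)%:E in nu2.
have [m m2E] : exists m : R, m2 = m%:E.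
  exists (fine m2); rewrite fineK// ge0_fin_numE//; apply: integral_ge0 => x _.
  by rewrite lee_fin sqr_ge0.
(* The moment of [S] is at most [2 delta + 2 m], hence that of [G] is at most
   [2 delta + 2 (2 delta + 2 m)], with [delta <= 1]. *)
exists (6 + 4 * m)%R => e e0.
pose A : R := ((2 * C) ^+ 2 / (e / 4) ^+ 3)%R.
have e4 : (0 < e / 4)%R by rewrite divr_gt0.
have A0 : (0 <= A)%R by apply: divr_ge0; [exact: sqr_ge0|rewrite exprn_ge0// ltW].
(* The bound 1 keeps the moments under control and gives [delta ^+ 2 <= delta]. The other bound
   gives [A * delta <= e / 4], so each of the two comparisons below costs at most [e / 2]. *)
pose delta := Num.min 1%R (e / 4 / (A + 1))%R.
have A1 : (0 < A + 1)%R by rewrite ltr_wpDl.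
have delta0 : (0 < delta)%R by rewrite lt_min ltr01 divr_gt0.
have delta1 : (delta <= 1)%R by rewrite ge_min lexx.
have Adelta : (A * delta <= e / 4)%R.
  have : (delta <= e / 4 / (A + 1))%R by rewrite ge_min lexx orbT.
  by rewrite ler_pdivlMr//; nra.
have [S [q [mS mq qd Sq]]] := approximate_transport nu mu0 delta0.
have q_dist : \int[nu]_x (enorm (q x - x) ^+ 2)%:E <= delta%:E.
  apply: (@le_trans _ _ (\int[nu]_x delta%:E)).
    apply: ge0_le_integral => //.
    - by move=> x _; rewrite lee_fin sqr_ge0.
    - by apply/measurable_EFinP; exact: measurable_sqr_enormB.
    - by move=> x _; rewrite lee_fin.
  by rewrite integral_cst//= probability_setT mule1.
have S_moment : \int[mu]_x (enorm (S x) ^+ 2)%:E <= (2 * delta + 2 * m)%:E.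
  rewrite (pushforward_integral_eq mS mq Sq (f := fun y => (enorm y ^+ 2)%:E)).
  - apply: (le_trans (integral_sqr_enorm_le nu mq mid)).
    rewrite -/m2 (_ : (2 * delta + 2 * m)%:E = 2%:E * delta%:E + 2%:E * m2).
      by rewrite leeD2r// lee_pmul2l.
    by rewrite m2E -!EFinM -EFinD.
  - by apply/measurable_EFinP; exact: measurable_sqr_enorm.
  - by left => x; rewrite lee_fin sqr_ge0.
have S_L2 : Lnorm mu 2%:E (fun x => (enorm (S x))%:E) < +oo.
  apply: Lnorm2_lty => [x|]; first exact: enorm_ge0.
  by rewrite (le_lt_trans S_moment)// ltry.
have [G netG GS] := dens S delta mS S_L2 delta0.
have mG : measurable_fun setT G by exact: networks_measurable sc _ _ _ netG.
have GS_dist : \int[mu]_x (enorm (G x - S x) ^+ 2)%:E <= delta%:E.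
  apply: (@le_trans _ _ (delta ^+ 2)%:E).
    by apply: integral_sqr_le => // [x|]; [exact: enorm_ge0|exact: ltW].
  by rewrite lee_fin expr2 ger_pMl.
exists G => //; split.
  apply: (le_trans (integral_sqr_enorm_le mu mG mS)).
  apply: (@le_trans _ _ (2%:E * delta%:E + 2%:E * (2 * delta + 2 * m)%:E)).
    by apply: leeD; rewrite lee_pmul2l.
  by rewrite -!EFinM -EFinD lee_fin; lra.
(* For each [f] in the unit ball, pass from [G] to [S] under [mu], then from [q] to the identity
   under [nu]; the integrals of [f] along [S] and [q] coincide. *)
apply: ge_ereal_sup => _ [f [Hf f1] <-].
have mf := measurable_rkhs_ball KC Hf f1.
have mfE : measurable_fun setT (EFin \o f) by exact/measurable_EFinP.
have intf (P : probability Rd R) (X : Rd -> Rd) : measurable_fun setT X ->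
    P.-integrable setT ((EFin \o f) \o X).
  by move=> mX; exact: (rkhs_ball_integrable KM KC Hf f1 P mX).
have int_fin (P : probability Rd R) (X : Rd -> Rd) : measurable_fun setT X ->
    exists a : R, \int[P]_x (f (X x))%:E = a%:E.
  move=> mX; exists (fine (\int[P]_x (f (X x))%:E)); rewrite fineK//.
  by apply: integrable_fin_num => //; exact: intf.
rewrite (integral_pushforward mG mfE (intf mu G mG) measurableT) preimage_setT /=.
have fSq : \int[mu]_x (f (S x))%:E = \int[nu]_x (f (q x))%:E.
  apply: (pushforward_integral_eq mS mq Sq mfE); right.
  by split; exact: intf.
have close (P : probability Rd R) (X Y : Rd -> Rd) : measurable_fun setT X ->
    measurable_fun setT Y -> \int[P]_x (enorm (X x - Y x) ^+ 2)%:E <= delta%:E ->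
    `| \int[P]_x (f (X x))%:E - \int[P]_x (f (Y x))%:E | <= (e / 2)%:E.
  move=> mX mY XY; apply: le_trans (rkhs_ball_integral_dist KM KC Hf f1 P mX mY e4) _.
  apply: (@le_trans _ _ ((e / 4)%:E + A%:E * delta%:E)).
    by rewrite leeD2l// lee_wpmul2l.
  by rewrite -EFinM -EFinD lee_fin; lra.
have := close mu G S mG mS GS_dist; have := close nu q id mq mid q_dist; rewrite -fSq /=.
have [a ->] := int_fin mu G mG; have [s ->] := int_fin mu S mS.
have [n ->] := int_fin nu id mid.
rewrite -!EFinB !abse_EFin !lee_fin => sn as_.
by have := ler_distD s a n; lra.
Qed.

End network_approximation.

(** * The penalized cost and its infimum *)

Section penalized_problem.
Context (R : realType) (d n L : nat) (sigma : R -> R).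
Local Notation Rd := 'rV[R]_d.
Context (K : Rd -> Rd -> R) (H : rkhs K) (mu : 'I_n.+2 -> probability Rd R).
Hypothesis sigma_continuous : continuous sigma.
Implicit Types (lambda : 'I_n.+2 -> R) (T : 'I_n.+2 -> Rd -> Rd) (i : 'I_n.+2).
Local Open Scope ereal_scope.

Lemma mmd_pushforward_ge0 (P nu : probability Rd R) (G : Rd -> Rd) :
  measurable_fun setT G -> 0 <= mmd H (pushforward P G) nu.
Proof.
move=> mG; pose Q : {mfun Rd >-> Rd} := HB.pack G (isMeasurableFun.Build _ _ _ _ G mG).
exact: (mmd_ge0 H (distribution P Q) nu).
Qed.

Lemma network_tuples_measurable T i :
  network_tuples sigma L T -> measurable_fun setT (T i : Rd -> Rd).
Proof.
move=> [T0 Tnet]; have [->|i0] := eqVneq i ord0.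
  by rewrite T0; exact: measurable_id.
by apply: (networks_measurable sigma_continuous); apply: Tnet; rewrite lt0n.
Qed.

Lemma penalty_term_ge0 lambda T i : network_tuples sigma L T -> (0 <= lambda i)%R ->
  0 <= (lambda i)%:E * mmd H (pushforward (mu ord0) (T i)) (mu i) ^+ 2.
Proof.
move=> /network_tuples_measurable mT l0; apply: mule_ge0; first by rewrite lee_fin.
by apply: expe_ge0; exact: mmd_pushforward_ge0.
Qed.

Lemma penalty_ge0 lambda T : network_tuples sigma L T ->
  (forall i : 'I_n.+2, (0 < i)%N -> (0 <= lambda i)%R) -> 0 <= penalty H mu lambda T.
Proof. by move=> netT l0; apply: sume_ge0 => i /l0; exact: penalty_term_ge0. Qed.

Lemma le_penalty lambda lambda' T : network_tuples sigma L T ->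
  (forall i : 'I_n.+2, (0 < i)%N -> (lambda i <= lambda' i)%R) ->
  penalty H mu lambda T <= penalty H mu lambda' T.
Proof.
move=> /network_tuples_measurable mT ll; apply: lee_sum => i /ll li.
by apply: lee_wpmul2r; [apply: expe_ge0; exact: mmd_pushforward_ge0|rewrite lee_fin].
Qed.

Lemma penalty_scale (a : R) lambda T : (0 <= a)%R -> network_tuples sigma L T ->
  (forall i : 'I_n.+2, (0 < i)%N -> (0 <= lambda i)%R) ->
  penalty H mu (fun i => a * lambda i)%R T = a%:E * penalty H mu lambda T.
Proof.
move=> a0 netT l0; rewrite /penalty ge0_sume_distrr; last first.
  by move=> i /l0; exact: penalty_term_ge0.
by apply: eq_bigr => i _; rewrite EFinM -muleA.
Qed.

Lemma quadratic_cost_ge0 (x : 'I_n.+2 -> Rd) : (0 <= quadratic_cost x)%R.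
Proof. by apply: sumr_ge0 => i _; apply: sumr_ge0 => j _; exact: sqr_ge0. Qed.

Lemma integral_cost_ge0 (T : 'I_n.+2 -> Rd -> Rd) :
  0 <= \int[mu ord0]_x (quadratic_cost (fun i => T i x))%:E.
Proof. by apply: integral_ge0 => x _; rewrite lee_fin quadratic_cost_ge0. Qed.

Lemma quadratic_cost_le (x : 'I_n.+2 -> Rd) :
  (quadratic_cost x <= \sum_(i < n.+2) (4 * n.+2%:R) * enorm (x i) ^+ 2)%R.
Proof.
pose a i := (2 * enorm (x i) ^+ 2)%R.
have a0 i : (0 <= a i)%R by rewrite mulr_ge0// sqr_ge0.
(* Enlarge the sum to all ordered pairs. Each [a i] then occurs [2 * n.+2] times, whence the factor
   [4 * n.+2]. *)
apply: (@le_trans _ _ (\sum_(i < n.+2) \sum_(j < n.+2) (a i + a j))%R).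
  apply: ler_sum => i _; rewrite [leRHS](bigID (fun j : 'I_n.+2 => (i < j)%N)) /=.
  apply: ler_wpDr; first by apply: sumr_ge0 => j _; rewrite addr_ge0.
  by apply: ler_sum => j _; exact: sqr_enormB_le.
under eq_bigr do rewrite big_split /= sumr_const card_ord.
rewrite big_split /= sumr_const card_ord -sumrMnl -big_split /=.
apply: ler_sum => i _; rewrite -mulrnDl /a -(mulr_natr (_ + _)); nra.
Qed.

Lemma integral_cost_le (T : 'I_n.+2 -> Rd -> Rd) :
  (forall i, measurable_fun setT (T i)) ->
  \int[mu ord0]_x (quadratic_cost (fun i => T i x))%:E <=
  \sum_(i < n.+2) (4 * n.+2%:R)%:E * \int[mu ord0]_x (enorm (T i x) ^+ 2)%:E.
Proof.
move=> mT.
have m2 i : measurable_fun setT (fun x => (enorm (T i x) ^+ 2)%:E).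
  by apply/measurable_EFinP; exact: measurable_sqr_enorm.
have s0 (z : Rd) : 0 <= (enorm z ^+ 2)%:E by rewrite lee_fin sqr_ge0.
have -> : \sum_(i < n.+2) (4 * n.+2%:R)%:E * \int[mu ord0]_x (enorm (T i x) ^+ 2)%:E =
    \int[mu ord0]_x \sum_(i < n.+2) (4 * n.+2%:R)%:E * (enorm (T i x) ^+ 2)%:E.
  rewrite ge0_integral_sum//.
  - by apply: eq_bigr => i _; rewrite ge0_integralZl.
  - by move=> i; exact: emeasurable_funM.
  - by move=> i x _; rewrite mule_ge0.
apply: ge0_le_integral => //.
- by move=> x _; rewrite lee_fin quadratic_cost_ge0.
- apply/measurable_EFinP; rewrite (_ : (fun x => quadratic_cost _) = fun x => \sum_(i < n.+2)
      \sum_(j < n.+2) if (i < j)%N then enorm (T i x - T j x) ^+ 2 else 0)%R.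
    apply: measurable_sum => i; apply: measurable_sum => j.
    by case: (i < j)%N => //; exact: measurable_sqr_enormB.
  by apply/funext => x; apply: eq_bigr => i _; rewrite big_mkcond.
- by apply: emeasurable_sum => i; exact: emeasurable_funM.
- move=> x _; apply: (@le_trans _ _
      (\sum_(i < n.+2) (4 * n.+2%:R) * enorm (T i x) ^+ 2)%R%:E).
    by rewrite lee_fin quadratic_cost_le.
  by rewrite -sumEFin.
Qed.

Definition penalized_value (lambda : 'I_n.+2 -> R) : \bar R :=
  ereal_inf [set penalized_cost H mu lambda S | S in network_tuples sigma L].

(** Every tuple costs at least as much under the larger weights, because the squared discrepancies
    are nonnegative. *)
Lemma le_penalized_value lambda lambda' :
  (forall i : 'I_n.+2, (0 < i)%N -> (lambda i <= lambda' i)%R) ->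
  penalized_value lambda <= penalized_value lambda'.
Proof.
move=> ll; apply: le_ereal_inf_tmp => _ [T netT <-].
apply: (@le_trans _ _ (penalized_cost H mu lambda T)).
  by apply: ereal_inf_lbound; exists T.
by apply: leeD => //; exact: le_penalty.
Qed.

Lemma penalized_value_ge0 lambda :
  (forall i : 'I_n.+2, (0 < i)%N -> (0 <= lambda i)%R) -> 0 <= penalized_value lambda.
Proof.
move=> l0; apply: le_ereal_inf_tmp => _ [T netT <-].
by apply: adde_ge0; [exact: integral_cost_ge0|exact: penalty_ge0].
Qed.

(* Compare the problems with parameters lambda and lambda / 2: the cost of T in
   the latter is its cost in the former minus half of its penalty. *)
Lemma almost_minimizer_penalty lambda T (eps : R) :
  (forall i : 'I_n.+2, (0 < i)%N -> (0 <= lambda i)%R) ->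
  network_tuples sigma L T -> penalized_value lambda < +oo ->
  penalized_cost H mu lambda T - eps%:E <= penalized_value lambda ->
  exists p : R, penalty H mu lambda T = p%:E /\
    (2^-1 * p)%:E <= penalized_value lambda + eps%:E -
      penalized_value (fun i => 2^-1 * lambda i)%R.
Proof.
move=> l0 netT; have := penalized_value_ge0 l0.
case: (penalized_value lambda) => [v| |]// _ _.
have l20 (i : 'I_n.+2) : (0 < i)%N -> (0 <= 2^-1 * lambda i)%R.
  by move=> /l0 li; rewrite mulr_ge0.
have := penalized_value_ge0 l20.
have : penalized_value (fun i => 2^-1 * lambda i)%R <=
    penalized_cost H mu (fun i => 2^-1 * lambda i)%R T.
  by apply: ereal_inf_lbound; exists T.
rewrite /penalized_cost penalty_scale//.
have := integral_cost_ge0 T; have := penalty_ge0 netT l0.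
(* Infinite cases contradict nonnegativity or the finite upper bound. In the finite case, subtract
   [w <= c + p / 2] from [c + p <= v + eps]. *)
case: (penalty _ _ _ _) => [p| |]//; case: (\int[_]_x _) => [c| |]//.
move=> p0 c0; case: (penalized_value _) => [w| |]//.
rewrite -!EFinM -!EFinD !lee_fin => wc w0 cv.
by exists p; split => //; rewrite lee_fin; lra.
Qed.

End penalized_problem.

(** * A bound on the infimum, uniform in the weights *)

Section value_bound.
Context (R : realType) (d n L : nat) (sigma : R -> R).
Local Notation Rd := 'rV[R]_d.+1.
Context (K : Rd -> Rd -> R) (H : rkhs K) (mu : 'I_n.+2 -> probability Rd R).
Local Open Scope ereal_scope.

(** Discrepancies of at most [1 / sqrt (lambda i)] make every penalty term at most 1, while second
    moments, bounded independently of the accuracy, control the transport cost. *)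
Lemma penalized_value_bounded : continuous sigma -> networks_dense sigma L (mu ord0) ->
  (forall i, vanishes_on_rectifiable d (mu i) /\ finite_second_moment (mu i)) ->
  bounded_kernel K -> lipschitz_kernel K ->
  exists b : R, forall lambda : 'I_n.+2 -> R,
    (forall i : 'I_n.+2, (0 < i)%N -> (0 < lambda i)%R) ->
    penalized_value L sigma H mu lambda <= b%:E.
Proof.
move=> sc dens A1 KM KC.
pose m := mu ord0.
(* The identity at [ord0] and the networks at the other indices are put in one statement, so that a
   single choice produces a whole tuple. *)
have [b Hb] : {b : 'I_n.+2 -> R & forall i (e : R), (0 < e)%R -> exists G : Rd -> Rd,
    [/\ i = ord0 -> G = id, \int[m]_x (enorm (G x) ^+ 2)%:E <= (b i)%:E &
        (0 < i)%N -> networks sigma L G /\ mmd H (pushforward m G) (mu i) <= e%:E]}.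
  apply: (choice (P := fun i b => forall e : R, (0 < e)%R -> exists G : Rd -> Rd,
    [/\ i = ord0 -> G = id, \int[m]_x (enorm (G x) ^+ 2)%:E <= b%:E &
        (0 < i)%N -> networks sigma L G /\ mmd H (pushforward m G) (mu i) <= e%:E])) => i.
  have [->|i0] := eqVneq i ord0.
    exists (fine (\int[m]_x (enorm x ^+ 2)%:E)) => e e0; exists id; split => //.
    rewrite fineK// ge0_fin_numE; first exact: (A1 ord0).2.
    by apply: integral_ge0 => x _; rewrite lee_fin sqr_ge0.
  have [b Hb] := networks_approximate H sc dens (A1 ord0).1 (A1 i).2 KM KC.
  exists b => e /Hb[G netG [Gb Ge]]; exists G; split => // iE.
  by rewrite iE eqxx in i0.
exists (\sum_(i < n.+2) (4 * n.+2%:R) * b i + \sum_(i < n.+2 | (0 < i)%N) 1)%R.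
move=> lambda l0.
(* The default 1 keeps [e] positive at [ord0], where the sign of [lambda] is unknown. *)
pose e i := if (0 < lambda i)%R then ((Num.sqrt (lambda i))^-1)%R else 1%R.
have e0 i : (0 < e i)%R by rewrite /e; case: ifPn => // li; rewrite invr_gt0 sqrtr_gt0.
have [T HT] := choice (fun i => Hb i (e i) (e0 i)).
have netT : network_tuples sigma L T.
  by split=> [|i i0]; [have [/(_ erefl)] := HT ord0|have [_ _ /(_ i0)[]] := HT i].
apply: (@le_trans _ _ (penalized_cost H mu lambda T)).
  by apply: ereal_inf_lbound; exists T.
rewrite EFinD; apply: leeD.
  apply: le_trans (integral_cost_le _ _) _ => [i|].
    exact: network_tuples_measurable sc _ _ netT.
  rewrite -sumEFin; apply: lee_sum => i _.
  apply: (@le_trans _ _ ((4 * n.+2%:R)%:E * (b i)%:E)); last by rewrite -EFinM.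
  by apply: lee_wpmul2l => //; have [] := HT i.
rewrite -sumEFin; apply: lee_sum => i i0; have [_ _ /(_ i0)[_]] := HT i.
have := mmd_pushforward_ge0 H m (mu i) (network_tuples_measurable sc i netT).
rewrite -/m /e l0//; case: (mmd _ _ _) => [r| |]//.
rewrite !lee_fin => r0 re; rewrite -expr2.
have sl : (0 < Num.sqrt (lambda i))%R by rewrite sqrtr_gt0 l0.
rewrite -[lambda i]sqr_sqrtr ?(ltW (l0 _ _))// -exprMn expr_le1//.
  by rewrite mulrC -ler_pdivlMr// div1r.
by rewrite mulr_ge0// ltW.
Qed.

End value_bound.

(** * Weak neighbourhoods given by one test function *)

Section weak_neighborhoods.
Context (R : realType) (d : nat).
Local Notation Rd := 'rV[R]_d.
Local Open Scope ereal_scope.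

Lemma bounded_continuous_integral_fin (f : Rd -> R) (nu : probability Rd R) :
  bounded_continuous f -> exists a : R, \int[nu]_x (f x)%:E = a%:E.
Proof.
move=> [cf [C fC]]; exists (fine (\int[nu]_x (f x)%:E)); rewrite fineK//.
apply: integrable_fin_num => //.
apply: (@le_integrable _ _ _ _ _ measurableT _ (cst C%:E)).
- by apply/measurable_EFinP; exact: continuous_measurable_rV_R.
- by move=> x _ /=; rewrite lee_fin (le_trans (fC x))// ler_norm.
- by apply/integrableP; split=> //; rewrite integral_cst//= probability_setT mule1 ltry.
Qed.

(** By the triangle inequality, the remaining radius [e - |a - m|] works around [nu]. Metrization
    then places an MMD ball inside such a set. *)
Lemma weakly_open_integral_ball (f : Rd -> R) (mu : probability Rd R) (e : R) :
  bounded_continuous f ->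
  weakly_open [set nu : probability Rd R |
    `| \int[nu]_x (f x)%:E - \int[mu]_x (f x)%:E | < e%:E].
Proof.
move=> bf nu /=.
have [m mE] := bounded_continuous_integral_fin mu bf.
have [a aE] := bounded_continuous_integral_fin nu bf.
rewrite [X in `|X - _|]aE [X in `|_ - X|]mE -EFinB abse_EFin lte_fin => ae.
exists 1%N, (fun=> f), (e - `|a - m|)%R; split => //; first by rewrite subr_gt0.
move=> xi /(_ ord0); have [b bE] := bounded_continuous_integral_fin xi bf.
rewrite /= [X in `|X - _| < _ -> _]bE [X in `|_ - X| < _ -> _]aE.
rewrite [X in _ -> `|X - _| < _]bE [X in _ -> `|_ - X| < _]mE.
rewrite -!EFinB !abse_EFin !lte_fin.
by have := ler_distD a b m; lra.
Qed.

End weak_neighborhoods.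

(** * Decay of the penalty, then weak convergence of the images *)

Theorem theorem1 (R : realType) (d n L : nat) (hd : (1 <= d)%N) (hL : (1 <= L)%N)
    (mu : 'I_n.+2 -> probability 'rV[R]_d R)
    (K : 'rV[R]_d -> 'rV[R]_d -> R) (H : rkhs K) (sigma : R -> R)
    (K_continuous : continuous (fun p : 'rV[R]_d * 'rV[R]_d => K p.1 p.2))
    (K_symmetric : forall x y, K x y = K y x)
    (K_spd : strictly_positive_definite K)
    (A1 : forall i, vanishes_on_rectifiable d.-1 (mu i) /\
                    finite_second_moment (mu i))
    (A2 : bounded_kernel K /\ lipschitz_kernel K)
    (A3 : mmd_metric H /\ mmd_metrizes_weak H)
    (A4 : [/\ continuous sigma, ~ (exists c, forall r, sigma r = c) &
              exists2 C : R, 0 < C &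
                forall r, `|sigma r| <= C * (1 + `|r| ^+ 2)])
    (A5 : networks_dense sigma L (mu ord0))
    (eps : R -> R) (lambda : R -> 'I_n.+2 -> R)
    (eps_gt0 : forall h, 0 < h < 1 -> 0 < eps h)
    (lambda_gt0 : forall h (i : 'I_n.+2), 0 < h < 1 -> (0 < i)%N ->
                    0 < lambda h i)
    (eps_mono : forall h h', 0 < h -> h <= h' -> h' < 1 -> eps h <= eps h')
    (eps_cvg : eps h @[h --> 0^'+] --> 0)
    (lambda_mono : forall h h' (i : 'I_n.+2), 0 < h -> h <= h' -> h' < 1 ->
                     (0 < i)%N -> lambda h' i <= lambda h i)
    (lambda_cvg : forall i : 'I_n.+2, (0 < i)%N ->
                    lambda h i @[h --> 0^'+] --> +oo)
    (T : R -> 'I_n.+2 -> 'rV[R]_d -> 'rV[R]_d)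
    (T_networks : forall h, 0 < h < 1 -> network_tuples sigma L (T h))
    (T_almost_min : forall h, 0 < h < 1 ->
       (penalized_cost H mu (lambda h) (T h) - (eps h)%:E <=
        ereal_inf [set penalized_cost H mu (lambda h) S |
                   S in network_tuples sigma L])%E) :
  penalty H mu (lambda h) (T h) @[h --> 0^'+] --> 0%E /\
  forall i : 'I_n.+2, (0 < i)%N ->
    converges_weakly (fun h => pushforward (mu ord0) (T h i)) (mu i).
Proof.
case: d hd mu K H K_continuous K_symmetric K_spd A1 A2 A3 A5 T T_networks T_almost_min =>
  [//|{}d] _ {}mu {}K {}H _ _ _ {}A1 [KM KC] [[_ _ mmdC _] mmd_weak] dens {}T netT almost_min.
have [sc _ _] := A4.
have [b Hb] := penalized_value_bounded H sc dens A1 KM KC.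
pose v h := penalized_value L sigma H mu (lambda h).
pose half h i := 2^-1 * lambda h i.
pose w h := penalized_value L sigma H mu (half h).
have l_ge0 h : 0 < h < 1 -> forall i : 'I_n.+2, (0 < i)%N -> 0 <= lambda h i.
  by move=> h01 i i0; rewrite ltW// lambda_gt0.
have v_fin h : 0 < h < 1 -> (v h = (fine (v h))%:E /\ fine (v h) <= b).
  move=> h01; have := penalized_value_ge0 L H mu sc (l_ge0 h h01).
  have := Hb (lambda h) (fun i => lambda_gt0 h i h01).
  by rewrite -/(v h); case: (v h).
have near01 : \forall h \near 0^'+, 0 < h < (1 : R).
  near=> h; apply/andP; split; near: h; first exact: nbhs_right_gt.
  by apply: nbhs_right_lt.
pose p h := penalty H mu (lambda h) (T h).
have pP h : 0 < h < 1 -> exists r : R, p h = r%:E /\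
    ((2^-1 * r)%:E <= v h + (eps h)%:E - w h)%E.
  move=> h01; apply: (almost_minimizer_penalty sc (l_ge0 _ h01) (netT _ h01)).
    by have [vE _] := v_fin _ h01; rewrite -/(v h) vE ltry.
  exact: almost_min.
have p0 h : 0 < h < 1 -> (0 <= p h)%E.
  by move=> h01; exact: penalty_ge0 sc _ _ (netT _ h01) (l_ge0 _ h01).
pose V := [set fine (v h) | h in [set h : R | 0 < h < 1]].
have V_sup : has_sup V.
  split; first by exists (fine (v 2^-1)), 2^-1 => //=; apply/andP; split; lra.
  by exists b => _ [h /v_fin[_ ?] <-].
have p_cvg : p h @[h --> 0^'+] --> 0%E.
  apply/fine_cvgP; split.
    by apply: filterS near01 => h /pP[r [-> _]].
  apply/cvgrPdist_lt => e e0.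
  have e4 : 0 < e / 4 by rewrite divr_gt0.
  (* Fix [h0] with [v h0] within [e / 4] of the supremum. Once [lambda h / 2] dominates [lambda h0],
     monotonicity gives [v h0 <= w h]. *)
  have [_ [h0 h001 <-] vh0] := sup_adherent e4 V_sup.
  have lambda_large : \forall h \near 0^'+, forall i : 'I_n.+2, (0 < i)%N ->
      lambda h0 i <= half h i.
    apply: filter_forall => i; have [i0|_] := boolP (0 < i)%N; last first.
      by apply: nearW.
    have /cvgryPge/(_ (2 * lambda h0 i)) := lambda_cvg i i0.
    by apply: filterS => h hl _; rewrite /half; lra.
  have /cvgrPdist_lt/(_ _ e4) eps_small := eps_cvg.
  near=> h.
  have h01 : 0 < h < 1 by near: h.
  have [r [pr pv]] := pP _ h01.
  have r0 : 0 <= r by rewrite -lee_fin -pr p0.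
  have [vE _] := v_fin _ h01.
  have vsup : fine (v h) <= sup V.
    by apply: ub_le_sup; [exact: V_sup.2|exists h].
  have epsh : eps h < e / 4.
    have : `|0 - eps h| < e / 4 by near: h.
    by rewrite sub0r normrN => /(le_lt_trans (ler_norm _)).
  have wh : (v h0 <= w h)%E.
    by apply: (le_penalized_value _ _ _ sc); near: h.
  change (`|0 - fine (p h)| < e); rewrite pr /= sub0r normrN ger0_norm//.
  (* Half the penalty is at most [v h + eps h - w h], which is less than
     [sup V + e / 4 - (sup V - e / 4) = e / 2]. *)
  move: pv wh; rewrite vE (v_fin _ h001).1.
  case: (w h) => [x| |]//; rewrite -EFinD ?lee_fin; lra.
split; first exact: p_cvg.
move=> i i0 f bf.
have [m mE] := bounded_continuous_integral_fin (mu i) bf.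
have mT h : 0 < h < 1 -> measurable_fun setT (T h i).
  by move=> h01; exact: network_tuples_measurable sc _ _ (netT _ h01).
rewrite mE; apply/fine_cvgP; split.
  apply: filterS near01 => h /mT mTh.
  pose Q : {mfun 'rV[R]_d.+1 >-> 'rV[R]_d.+1} :=
    HB.pack (T h i) (isMeasurableFun.Build _ _ _ _ (T h i) mTh).
  by have [a] := bounded_continuous_integral_fin (distribution (mu ord0) Q) bf => ->.
apply/cvgrPdist_lt => e e0.
(* Metrization turns the weak neighbourhood of [mu i] into an MMD ball of some radius [r]. It
   remains to make the penalty smaller than [r ^+ 2] while [lambda h i >= 1]. *)
have ball_open := (mmd_weak _).2 (@weakly_open_integral_ball R d.+1 f (mu i) e bf).
have [|r r0 Hr] := ball_open (mu i); first by rewrite /= mE -EFinB subrr abse0 lte_fin.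
have r2 : 0 < r ^+ 2 by rewrite exprn_gt0.
have /fine_cvgP[_ /cvgrPdist_lt/(_ _ r2) p_small] := p_cvg.
have /cvgryPge/(_ 1) lambda_ge1 := lambda_cvg i i0.
near=> h.
have h01 : 0 < h < 1 by near: h.
have mTh := mT _ h01.
pose Q : {mfun 'rV[R]_d.+1 >-> 'rV[R]_d.+1} :=
  HB.pack (T h i) (isMeasurableFun.Build _ _ _ _ (T h i) mTh).
have mmd_small : (mmd H (mu i) (distribution (mu ord0) Q) < r%:E)%E.
  have [s [ps _]] := pP _ h01.
  have sr : s < r ^+ 2.
    have : `|0 - fine (p h)| < r ^+ 2 by near: h.
    by rewrite ps sub0r normrN => /(le_lt_trans (ler_norm _)).
  have l1 : 1 <= lambda h i by near: h.
  rewrite mmdC; have : ((lambda h i)%:E *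
      mmd H (pushforward (mu ord0) (T h i)) (mu i) ^+ 2 <= s%:E)%E.
    rewrite -ps /p /penalty (bigD1 i)//= leeDl//.
    apply: sume_ge0 => j /andP[j0 _].
    exact: penalty_term_ge0 sc _ _ _ (netT _ h01) (l_ge0 _ h01 _ j0).
  have : (0 <= mmd H (distribution (mu ord0) Q) (mu i))%E by exact: mmd_ge0.
  rewrite -[pushforward _ _]/(distribution (mu ord0) Q).
  case: (mmd H _ _) => [x| |]//.
    rewrite !lee_fin lte_fin => x0 ls; rewrite ltNge; apply/negP => rx.
    have := le_lt_trans ls sr; rewrite ltNge => /negP; apply.
    by rewrite expr2 (@le_trans _ _ (x * x))// ?ler_peMl ?mulr_ge0// ler_pM// ltW.
  (* An infinite discrepancy would make its penalty term infinite, against the bound [s]. *)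
  by rewrite expe2 mulyy gt0_muley ?lte_fin// (lt_le_trans _ l1).
have := Hr _ mmd_small => /=.
have [a aE] := bounded_continuous_integral_fin (distribution (mu ord0) Q) bf.
rewrite [X in (`|X - _|)%E]aE [X in (`|_ - X|)%E]mE -EFinB abse_EFin lte_fin distrC => am.
by change (`|m - fine (\int[distribution (mu ord0) Q]_x (f x)%:E)| < e); rewrite aE.
Unshelve. all: by end_near. Qed.
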